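(* Let $n \ge 0$ be an integer and consider either of the following two models of a random graph of order $k$: (Model 2.5) a graph chosen uniformly at random from the $2^{\binom{k}{2}}$ labelled graphs on $k$ vertices; (Model 3) a graph chosen uniformly at random from the set of all unlabelled graphs (isomorphism classes of graphs) on $k$ vertices. In each of these models, if $k \geq 2n+9$, then most graphs of order $k$ are not $n$-apex. Here ''most'' means that the probability that the random graph has the property is at least $\frac12$.
   Context: Graphs are finite and simple (no loops or multiple edges). The order of a graph is its number of vertices. A graph is $n$-apex if it becomes planar on the deletion of $n$ or fewer vertices (so $0$-apex means planar). *)

(* Defs.v *)
From HB Require Import structures.
From mathcomp Require Import all_boot all_order all_algebra all_fingroup.
From mathcomp Require Import all_classical all_reals all_analysis.
Import numFieldNormedType.Exports.

Set Implicit Arguments.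
Unset Strict Implicit.
Unset Printing Implicit Defensive.

Import Order.TTheory GRing.Theory Num.Theory.

Local Open Scope ring_scope.

Record sgraph (V : finType) := SGraph {
  edges : {set {set V}};
  edges_card2 : edges \subset [set e : {set V} | #|e| == 2%N]%SET }.

Section SGraphFinType.
Variable V : finType.

HB.instance Definition _ := [isSub for @edges V].
HB.instance Definition _ := [Finite of sgraph V by <:].

Lemma card_sgraph : #|{: sgraph V}| = (2 ^ 'C(#|V|, 2))%N.
Proof.
rewrite -[LHS]cardsT -(card_imset _ val_inj) -card_draws -card_powerset.
apply: eq_card => E; rewrite inE; apply/imsetP/idP => [[G _ ->]|hE].
  exact: edges_card2.
by exists (SGraph hE).
Qed.

End SGraphFinType.

Definition adj (V : finType) (G : sgraph V) (x y : V) : bool :=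
  [set x; y]%SET \in edges G.

Section Deletion.
Variables (V : finType) (G : sgraph V) (S : {set V}).

Definition del_edges : {set {set {x : V | x \notin S}}} :=
  [set e : {set {x : V | x \notin S}} | (val @: e)%SET \in edges G]%SET.

Fact del_edges_card2 : del_edges \subset
  [set e : {set {x : V | x \notin S}} | #|e| == 2%N]%SET.
Proof.
apply/fintype.subsetP => e; rewrite !inE => he.
have := fintype.subsetP (edges_card2 G) _ he.
by rewrite inE card_imset //; exact: val_inj.
Qed.

Definition del_vertices : sgraph {x : V | x \notin S} := SGraph del_edges_card2.

End Deletion.

(* [p v] is the point representing the vertex [v]; the edge [e] is represented
   by the image of [0, 1] under [a e]; the values of [a e] off [0, 1], and of
   [a] off the edge set, are irrelevant. *)
Definition plane_drawing (R : realType) (V : finType) (G : sgraph V)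
    (p : V -> R * R) (a : {set V} -> R -> R * R) : Prop :=
  [/\ injective p,
      forall e, e \in edges G ->
        [/\ {within `[0, 1], continuous (a e)}%classic,
            {in `[0, 1] &, injective (a e)} &
            [set a e 0; a e 1]%classic = [set p v | v in [set` e]]%classic],
      forall e, e \in edges G -> forall (t : R) v, t \in `]0, 1[ -> a e t <> p v &
      forall e e', e \in edges G -> e' \in edges G -> e != e' ->
        forall s t : R, s \in `]0, 1[ -> t \in `]0, 1[ -> a e s <> a e' t].

Definition planar (R : realType) (V : finType) (G : sgraph V) : Prop :=
  exists p a, @plane_drawing R V G p a.

Definition n_apex (R : realType) (n : nat) (V : finType) (G : sgraph V) : Prop :=
  exists2 S : {set V}, (#|S| <= n)%N & planar R (del_vertices G S).

Definition sgraph_iso (V : finType) : rel (sgraph V) :=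
  [rel G H | [exists s : {perm V},
     [forall x, forall y, adj H (s x) (s y) == adj G x y]]].

Lemma sgraph_iso_equiv (V : finType) : equivalence_rel (@sgraph_iso V).
Proof.
have refl G : sgraph_iso G G.
  apply/existsP; exists 1%g; apply/'forall_forallP => x y.
  by rewrite !perm1.
have sym G H : sgraph_iso G H -> sgraph_iso H G.
  move=> /existsP[s /'forall_'forall_eqP h]; apply/existsP; exists s^-1%g.
  by apply/'forall_'forall_eqP => x y; rewrite -h !permKV.
have trans G H K : sgraph_iso G H -> sgraph_iso H K -> sgraph_iso G K.
  move=> /existsP[s /'forall_'forall_eqP h] /existsP[t /'forall_'forall_eqP h'].
  apply/existsP; exists (s * t)%g.
  by apply/'forall_'forall_eqP => x y; rewrite !permM h'.
move=> G H K; split=> // hGH; apply/idP/idP; last exact: trans.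
by apply: trans; apply: sym.
Qed.

Lemma planar_inj (R : realType) (V W : finType) (G : sgraph V) (H : sgraph W)
    (f : W -> V) : injective f ->
  (forall e, e \in edges H -> (f @: e)%SET \in edges G) ->
  planar R G -> planar R H.
Proof.
move=> f_inj fE [p [a [p_inj arc avoid disj]]].
exists (p \o f), (fun e : {set W} => a (f @: e)%SET); split.
- by apply: inj_comp.
- move=> e he; have [cont inj ends] := arc _ (fE _ he); split=> //.
  rewrite ends; apply/seteqP; split=> z /= [v].
    by move=> /imsetP[w ew ->] <-; exists w.
  by move=> ev <-; exists (f v) => //; apply/imsetP; exists v.
- by move=> e he t v ht; apply: avoid => //; exact: fE.
- move=> e e' he he' ne s t hs ht; apply: disj => //; [exact: fE|exact: fE|].
  by apply: contra_neq ne; exact: imset_inj.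
Qed.

Lemma n_apex_iso (R : realType) (n : nat) (V : finType) (G H : sgraph V) :
  sgraph_iso H G -> n_apex R n G -> n_apex R n H.
Proof.
move=> /existsP[s /'forall_'forall_eqP h] [S hS pl].
exists (s @^-1: S)%SET; first by rewrite card_preimset //; exact: perm_inj.
have f_out (x : {x | x \notin (s @^-1: S)%SET}) : s (val x) \notin S.
  by have := valP x; rewrite inE.
pose f x : {x | x \notin S} := Sub (s (val x)) (f_out x).
apply: (planar_inj (f := f)) pl => [x y /(congr1 val)/= /perm_inj/val_inj //|e].
rewrite !inE => he.
have := fintype.subsetP (edges_card2 H) _ he; rewrite inE => /cards2P[x [y [_ exy]]].
suff -> : (val @: (f @: e))%SET = [set s x; s y]%SET.
  by have := h x y; rewrite /adj -exy he.
rewrite -imset_comp (eq_imset (g := s \o val)) // imset_comp exy.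
by rewrite imsetU1 imset_set1.
Qed.

(* An unlabelled graph is represented by its isomorphism class. *)
Definition unlabelled_graphs (V : finType) : {set {set sgraph V}} :=
  equivalence_partition (@sgraph_iso V) [set: sgraph V]%SET.

(* The probability of [P] for a uniformly random element of [Omega]. *)
Definition unif_prob (T : finType) (Omega : {set T}) (P : T -> Prop) : rat :=
  #|[set x in Omega | `[< P x >]]%SET|%:R / #|Omega|%:R.

(* Main.v *)
Require Import Defs.
From mathcomp Require Import all_boot all_order all_algebra all_fingroup.
From mathcomp Require Import all_classical all_reals all_analysis.
From mathcomp Require Import lra ring.
Import numFieldNormedType.Exports.
Import Order.TTheory GRing.Theory Num.Theory.

(** If a graph and its complement were both n-apex, deleting two witnessing
    sets of at most n vertices each would leave at least nine vertices, and on
    these a graph and its complement would both be planar.  By a theorem of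
    Battle, Harary and Kodama, and of Tutte, no graph with nine vertices is like
    that ([not_biplanar9]).  So complementation, which is an involution on
    labelled graphs and on isomorphism classes, sends every n-apex graph to one
    that is not n-apex, and at most half of the graphs are n-apex
    ([unif_prob_half]).

    Planarity is used through one consequence only, the vanishing of the mod 2
    van Kampen obstruction ([planar_van_kampen]).  For a vertex w and an arc f
    that avoids it, let x(w, f) be the parity of the number of times the vector
    from w to a point running along f crosses the positive horizontal half-axis.
    If the arcs e (from a to b) and f (from c to d) are disjoint, then
    e(s) - f(t) has no zero on the unit square, so the crossings along its
    boundary are even in number.  The four sides of the square contribute
    x(c, e), x(d, e), x(a, f), x(b, f), except that two sides carry the vectors
    with the opposite sign; this changes the parity by an amount that depends
    on the positions of a, b, c, d alone.  The outcome is a system of linear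
    equations over the field with two elements, one for each pair of disjoint
    edges.  The parity statement itself is elementary: on a sufficiently fine
    subdivision of the square, the vectors at the corners of each cell lie in a
    common open half-plane, where crossings are easy to count, and the cells add
    up to the square ([winding_square], [grid_separation]).

    The equations add up along paths, hence also hold for vertex-disjoint paths.
    In a subdivision of K5 or of K(3,3), summing them over all pairs of disjoint
    edges cancels every unknown and leaves 0 = 1 ([odd_subdivision]).

    What remains is finite: each red-blue colouring of the pairs of nine
    points contains a subdivision of K5 or K(3,3) in one colour.  This rests on
    a catalogue of partial colourings found by computer search.  None
    of them extends to a colouring without such a subdivision; this is shown
    by branching on the colours of further pairs until a subdivision or a copy
    of a previous member of the catalogue appears ([refutes_avoided],
    [catalogue_valid]).  Referring to copies takes care of the symmetry under
    permutations of the points and exchange of the colours. *)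

Set Implicit Arguments.
Unset Strict Implicit.
Unset Printing Implicit Defensive.

(** * The mod 2 van Kampen obstruction *)

(** The system of equations that a plane drawing of [e] solves. The vertices
    a, b, c, d being those of two disjoint edges, [x a c d] is the parity
    attached to the vertex a and the edge cd, and [tau] stands for the relative
    position of two vertices.  The right-hand side counts, mod 2, the crossings
    of the chords ab and cd when the vertices are placed on a circle in the
    order [tau].  Reversing [tau] on a pair uv amounts to complementing [x u v w]
    and [x u w v] for every w, so all tournaments [tau] give equivalent systems. *)
Definition van_kampen_trivial (V : eqType) (e : rel V) : Prop :=
  exists (tau : rel V) (x : V -> V -> V -> bool),
    (forall a b, a != b -> tau a b = ~~ tau b a) /\
    (forall a b c d, uniq [:: a; b; c; d] -> e a b -> e c d ->
       x a c d (+) x b c d (+) x c a b (+) x d a b =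
       tau a c (+) tau a d (+) tau b c (+) tau b d).

Lemma van_kampen_trivial_inj (V W : eqType) (e : rel V) (e' : rel W) (f : W -> V) :
  injective f -> (forall a b, a != b -> e' a b -> e (f a) (f b)) ->
  van_kampen_trivial e -> van_kampen_trivial e'.
Proof.
move=> f_inj e'e [tau [x [tauC xE]]].
exists (fun a b => tau (f a) (f b)), (fun a c d => x (f a) (f c) (f d)).
split=> [a b ab|a b c d U ab cd]; first by apply: tauC; rewrite (inj_eq f_inj).
apply: xE; first by rewrite -(map_inj_uniq f_inj) in U.
  by apply: e'e ab; move: U; rewrite /= !inE !negb_or => /andP[/and3P[]].
by apply: e'e cd; move: U; rewrite /= !inE => /and4P[].
Qed.

Section Walks.
Variables (V : eqType) (e : rel V) (tau : rel V) (x : V -> V -> V -> bool).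
Hypothesis xE : forall a b c d, uniq [:: a; b; c; d] -> e a b -> e c d ->
  x a c d (+) x b c d (+) x c a b (+) x d a b =
  tau a c (+) tau a d (+) tau b c (+) tau b d.

Fixpoint along w u (q : seq V) : bool :=
  if q is v :: q' then x w u v (+) along w v q' else false.

(** Consecutive equations share the unknowns and the constants of the common
    vertex of two consecutive edges, so these cancel in the sum. *)
Lemma along_edge u q c d : path e u q -> e c d -> uniq [:: c, d, u & q] ->
  along c u q (+) along d u q (+) x u c d (+) x (last u q) c d =
  tau u c (+) tau u d (+) tau (last u q) c (+) tau (last u q) d.
Proof.
elim: q u => [|v q IH] u; first by move=> /= *; do 2 case: tau; case: x.
rewrite [path _ _ _]/= => /andP[euv pq] ecd U.
have /IH := pq => /(_ ecd).
have -> : uniq [:: c, d, v & q].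
  exact: subseq_uniq (cat_subseq (subseq_refl [:: c; d]) (subseq_cons (v :: q) u)) U.
move=> /(_ isT) {}IH.
have := xE (a := u) (b := v) (c := c) (d := d) _ euv ecd.
have -> : uniq [:: u; v; c; d].
  move: U; rewrite /= !inE !negb_or => /and4P[/and4P[-> cu cv _] /and3P[du dv _] /andP[-> _] _].
  by rewrite !(eq_sym u) !(eq_sym v) cu cv du dv.
move=> /(_ isT); move: IH => /=.
case: (along c v q); case: (along d v q); case: (x u c d); case: (x v c d);
case: (x c u v); case: (x d u v); case: (x (last v q) c d);
case: (tau u c); case: (tau u d); case: (tau v c); case: (tau v d); by case: tau; case: tau.
Qed.

Lemma along_along u q u' q' : path e u q -> path e u' q' -> uniq (u :: q ++ u' :: q') ->
  along u' u q (+) along (last u' q') u q (+) along u u' q' (+) along (last u q) u' q' =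
  tau u u' (+) tau u (last u' q') (+) tau (last u q) u' (+) tau (last u q) (last u' q').
Proof.
elim: q' u' => [|v q' IH] u' pq; first by move=> /= *; do 2 case: tau; case: along.
rewrite [path _ _ _]/= => /andP[euv pq'] U.
have /IH := pq' => /(_ pq).
have -> : uniq (u :: q ++ v :: q').
  exact: subseq_uniq (cat_subseq (subseq_refl (u :: q)) (subseq_cons (v :: q') u')) U.
move=> /(_ isT) {}IH.
have := along_edge pq euv.
have -> : uniq [:: u', v, u & q].
  have : uniq ([:: u', v & q'] ++ u :: q) by rewrite uniq_catC cat_cons.
  exact: subseq_uniq (cat_subseq (prefix_subseq [:: u'; v] q') (subseq_refl (u :: q))).
move=> /(_ isT); move: IH => /=.
case: (along u' u q); case: (along v u q); case: (x u u' v); case: (along u v q');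
case: (x (last u q) u' v); case: (along (last u q) v q'); case: (along (last v q') u q);
case: (tau u u'); case: (tau u v); case: (tau (last u q) u'); case: (tau (last u q) v);
by case: tau; case: tau.
Qed.
End Walks.

(** * Subdivisions of K5 and of K(3,3) *)

Lemma addb_even_count (T : eqType) (s : seq T) (f : T -> bool) :
  all (fun t => ~~ odd (count_mem t s)) s -> \big[addb/false]_(t <- s) f t = false.
Proof.
move=> /allP h; rewrite -big_undup_iterop_count big1_seq // => t /=.
rewrite mem_undup Monoid.iteropE => /h.
have -> n : iter n (addb (f t)) false = odd n && f t by elim: n => //= n ->; case: odd; case: f.
by move/negbTE ->.
Qed.

(** The unknowns in the equation of the pair of edges [q]. *)
Definition incidences (q : (nat * nat) * (nat * nat)) :=
  [:: (q.1.1, q.2); (q.1.2, q.2); (q.2.1, q.1); (q.2.2, q.1)].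
Definition joins (q : (nat * nat) * (nat * nat)) :=
  [:: (q.1.1, q.2.1); (q.1.1, q.2.2); (q.1.2, q.2.1); (q.1.2, q.2.2)].
Definition evenly (T : eqType) (s : seq T) := all (fun t => ~~ odd (count_mem t s)) s.

(** A computable witness that the equations of the pairs in [qs] add up to
    0 = 1: the unknowns cancel, the values of tau cancel once each is written
    with its smaller argument first, and an odd number of complements
    comes from this rewriting. *)
Definition odd_crossing qs :=
  [&& evenly (flatten (map incidences qs)),
      evenly [seq (minn t.1 t.2, maxn t.1 t.2) | t <- flatten (map joins qs)] &
      odd (count (fun t => t.2 < t.1) (flatten (map joins qs)))].

Lemma odd_crossing_unsolvable qs (tau : rel nat) (x : nat -> nat * nat -> bool) :
  (forall q, q \in qs -> \big[addb/false]_(t <- incidences q) x t.1 t.2 =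
     \big[addb/false]_(t <- joins q) tau t.1 t.2) ->
  (forall q t, q \in qs -> t \in joins q -> tau t.1 t.2 = ~~ tau t.2 t.1) ->
  odd_crossing qs -> False.
Proof.
move=> xE tauC /and3P[evx evtau].
have : \big[addb/false]_(t <- flatten (map incidences qs)) x t.1 t.2 =
       \big[addb/false]_(t <- flatten (map joins qs)) tau t.1 t.2.
  by rewrite !big_flatten !big_map; apply: eq_big_seq.
rewrite addb_even_count //.
have -> : \big[addb/false]_(t <- flatten (map joins qs)) tau t.1 t.2 =
    \big[addb/false]_(t <- flatten (map joins qs))
      (tau (minn t.1 t.2) (maxn t.1 t.2) (+) (t.2 < t.1)).
  apply: eq_big_seq => t /flatten_mapP[q hq ht].
  by case: ltnP => _; rewrite ?addbF // addbT (tauC q).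
rewrite big_split /= -(big_map (fun t => (minn t.1 t.2, maxn t.1 t.2)) xpredT (fun t => tau t.1 t.2)).
rewrite addb_even_count //= => h.
have -> : odd (count (fun t : nat * nat => t.2 < t.1) (flatten (map joins qs))) =
    \big[addb/false]_(t <- flatten (map joins qs)) (t.2 < t.1).
  by elim: flatten => [|t s IH]; rewrite ?big_nil // big_cons /= oddD IH; case: ltnP.
by rewrite -h.
Qed.

(** The vertices [h] and the inner vertices [r] of the paths between them
    describe a subdivision, in [e], of a graph on the natural numbers some of
    whose pairs of disjoint edges are listed in [qs]. *)
Lemma odd_subdivision (V : eqType) (e : rel V) qs (h : nat -> V) (r : nat * nat -> seq V) :
  van_kampen_trivial e -> odd_crossing qs ->
  (forall q d, q \in qs -> d \in [:: q.1; q.2] -> path e (h d.1) (rcons (r d) (h d.2))) ->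
  (forall q, q \in qs -> uniq (h q.1.1 :: rcons (r q.1) (h q.1.2) ++
                               h q.2.1 :: rcons (r q.2) (h q.2.2))) ->
  False.
Proof.
move=> [tau [x [tauC xE]]] odd_qs walk disj.
apply: (@odd_crossing_unsolvable qs (fun i j => tau (h i) (h j))
  (fun i d => along x (h i) (h d.1) (rcons (r d) (h d.2)))) odd_qs => [q qs_q|q t qs_q].
  have w1 := walk q q.1 qs_q (mem_head _ _); have w2 := walk q q.2 qs_q (mem_last _ [:: _]).
  have := along_along xE w1 w2 (disj q qs_q).
  rewrite !last_rcons /incidences /joins !big_cons !big_nil /= !addbF !addbA => <-.
  move: (along _ _ _ _) => a1; move: (along _ _ _ _) => a2; move: (along _ _ _ _) => a3.
  by move: (along _ _ _ _) => a4; case: a1 a2 a3 a4 => [] [] [] [].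
move=> ht; apply: tauC; move: (disj q qs_q); rewrite -cat_cons cat_uniq.
move=> /and3P[_ /hasPn apart _]; apply: contraTneq (apart (h t.2) _) => [<-|].
  by move: ht; rewrite negbK !inE mem_rcons !inE => /or4P[]/eqP -> /=; rewrite eqxx ?orbT.
by move: ht; rewrite !inE mem_rcons !inE => /or4P[]/eqP -> /=; rewrite eqxx ?orbT.
Qed.

Definition disjoint_pairs (es : seq (nat * nat)) :=
  [seq q <- [seq (d, d') | d <- es, d' <- es] |
     (q.1.1 < q.2.1) && uniq [:: q.1.1; q.1.2; q.2.1; q.2.2]].
Definition K33_edges := [seq (i, j) | i <- iota 0 3, j <- iota 3 3].
Definition K5_edges := [seq d <- [seq (i, j) | i <- iota 0 5, j <- iota 0 5] | d.1 < d.2].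

Lemma K33_odd : odd_crossing (disjoint_pairs K33_edges). Proof. by vm_compute. Qed.
Lemma K5_odd : odd_crossing (disjoint_pairs K5_edges). Proof. by vm_compute. Qed.

(** * Refutations of partial colourings of nine points *)

Fixpoint decimal_digits (u : Decimal.uint) : seq nat :=
  match u with
  | Decimal.Nil => [::]
  | Decimal.D0 u => 0 :: decimal_digits u | Decimal.D1 u => 1 :: decimal_digits u
  | Decimal.D2 u => 2 :: decimal_digits u | Decimal.D3 u => 3 :: decimal_digits u
  | Decimal.D4 u => 4 :: decimal_digits u | Decimal.D5 u => 5 :: decimal_digits u
  | Decimal.D6 u => 6 :: decimal_digits u | Decimal.D7 u => 7 :: decimal_digits u
  | Decimal.D8 u => 8 :: decimal_digits u | Decimal.D9 u => 9 :: decimal_digits u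
  end.

(** Numerals, with their leading zeros, serve as compact lists of points. *)
Definition digits (u : Number.uint) : seq nat :=
  if u is Number.UIntDecimal d then decimal_digits d else [::].

Fixpoint two_by_two (s : seq nat) : seq (nat * nat) :=
  if s is x :: y :: s' then (x, y) :: two_by_two s' else [::].
Definition digit_pairs u := two_by_two (digits u).

(** A proof by cases that a partial colouring is impossible; [true] is red.
    - [On i j t1 t0] decides the colour of the pair ij: [t1] if it is red,
      [t0] if it is blue.
    - [K33 c u] and [K5 c u] exhibit a subdivision of colour [c].  The first six,
      respectively five, digits of [u] are its branch vertices; each following
      pair of digits kv says that v subdivides the edge number k, the vertices
      of one edge being listed in the order of its path.
    - [Earlier k flip u] exhibits a copy of the partial colouring that comes [k]
      places before the previous one in the catalogue, with colours exchanged
      if [flip]; the digit number i of [u] is the image of the point i. *)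
Inductive refutation :=
  | On of nat & nat & refutation & refutation
  | K33 of bool & Number.uint
  | K5 of bool & Number.uint
  | Earlier of nat & bool & Number.uint.

Record entry := Entry { red : Number.uint; blue : Number.uint; cases : refutation }.

Arguments K33 _ _%_dec_uint_scope.
Arguments K5 _ _%_dec_uint_scope.
Arguments Earlier _ _ _%_dec_uint_scope.
Arguments Entry _%_dec_uint_scope _%_dec_uint_scope _.

(** A table rather than a function, so that a look-up does not
    retrace the history of the colouring. *)
Definition coloring := seq (seq (option bool)).
Definition color_of (st : coloring) i j := nth None (nth [::] st i) j.
Definition put (st : coloring) i j c : coloring :=
  set_nth [::] st i (set_nth None (nth [::] st i) j (Some c)).
Definition paint c st (d : nat * nat) := put (put st d.1 d.2 c) d.2 d.1 c.
Definition coloring_of (p : entry) :=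
  foldl (paint false) (foldl (paint true) [::] (digit_pairs (red p))) (digit_pairs (blue p)).

Definition subdividers es (inner : seq (nat * nat)) (d : nat * nat) :=
  [seq p.2 | p <- inner & p.1 == index d es].

(** The default 9 is not a point, so a missing vertex has no coloured pair. *)
Definition subdivides (st : coloring) c es (hubs : seq nat) (inner : seq (nat * nat)) :=
  let r := subdividers es inner in
  let h := nth 9 hubs in
  all (fun d => path (fun i j => color_of st i j == Some c) (h d.1) (rcons (r d) (h d.2))) es &&
  all (fun q => uniq (h q.1.1 :: rcons (r q.1) (h q.1.2) ++ h q.2.1 :: rcons (r q.2) (h q.2.2)))
    (disjoint_pairs es).

Definition embeds (p : entry) (flip : bool) (s : seq nat) (st : coloring) :=
  [&& size s == 9, uniq s, all (gtn 9) s,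
  all (fun d => color_of st (nth 9 s d.1) (nth 9 s d.2) == Some (~~ flip)) (digit_pairs (red p)) &
  all (fun d => color_of st (nth 9 s d.1) (nth 9 s d.2) == Some flip) (digit_pairs (blue p))].

Fixpoint refutes (known : seq entry) (st : coloring) (t : refutation) : bool :=
  match t with
  | On i j t1 t0 =>
      [&& i < 9, j < 9, refutes known (paint true st (i, j)) t1 &
          refutes known (paint false st (i, j)) t0]
  | K33 c u => subdivides st c K33_edges (take 6 (digits u)) (two_by_two (drop 6 (digits u)))
  | K5 c u => subdivides st c K5_edges (take 5 (digits u)) (two_by_two (drop 5 (digits u)))
  | Earlier k flip u => if onth known k is Some p then embeds p flip (digits u) st else false
  end.

(** The refutation [root] is that of the colouring with nothing coloured; [known]
    holds the entries already checked, the most recent one first. *)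
Fixpoint valid (known es : seq entry) (root : refutation) : bool :=
  if es is p :: es' then
    refutes known (coloring_of p) (cases p) && valid (p :: known) es' root
  else refutes known [::] root.

Section Soundness.
Variables (V : eqType) (e : rel V).
Hypothesis e_sym : symmetric e.
Hypothesis colors_trivial : forall c, van_kampen_trivial (fun u v => e u v == c).

(** [flip] exchanges the two colours. *)
Definition occurs (h : nat -> V) (flip : bool) (st : coloring) :=
  {in gtn 9 &, injective h} /\
  forall i j c, color_of st i j = Some c ->
    [/\ i < 9, j < 9 & e (h i) (h j) = c (+) flip].
Definition avoided st := forall h flip, ~ occurs h flip st.

Lemma color_of_paint c st i j x y : color_of (paint c st (i, j)) x y =
  if (x == i) && (y == j) || (x == j) && (y == i) then Some c else color_of st x y.
Proof.
have putE st' i' j' x' y' : color_of (put st' i' j' c) x' y' =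
    if (x' == i') && (y' == j') then Some c else color_of st' x' y'.
  rewrite /color_of /put nth_set_nth /=; case: eqP => //= ->.
  by rewrite nth_set_nth /=; case: eqP.
by rewrite /paint !putE /= orbC; case: ifP.
Qed.

Lemma occurs_paint c st h flip i j : i < 9 -> j < 9 -> e (h i) (h j) = c (+) flip ->
  occurs h flip st -> occurs h flip (paint c st (i, j)).
Proof.
move=> i9 j9 eij [h_inj st_h]; split=> // x y c'; rewrite color_of_paint.
case: ifP => [/orP[]/andP[/eqP -> /eqP ->] [<-]|_ /st_h //]; first by split.
by split=> //; rewrite e_sym.
Qed.

(** In whichever actual colour the subdivision appears, that colour class would
    solve a system without solution. *)
Lemma subdivides_avoided st c es hubs inner :
  odd_crossing (disjoint_pairs es) -> subdivides st c es hubs inner -> avoided st.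
Proof.
move=> odd_es /andP[/allP walks /allP disj] h flip [h_inj st_h].
set r := subdividers es inner in walks disj.
have pairs_es q d : q \in disjoint_pairs es -> d \in [:: q.1; q.2] -> d \in es.
  rewrite mem_filter => /andP[_ /allpairsP[[d1 d2] [/= d1es d2es ->]]].
  by rewrite !inE => /orP[]/eqP ->.
have bounded d : d \in es -> all (gtn 9) (nth 9 hubs d.1 :: rcons (r d) (nth 9 hubs d.2)).
  move=> /walks walk; have walk_lt i s :
      path (fun i j => color_of st i j == Some c) i s -> all (gtn 9) s.
    by elim: s i => //= j s IH i /andP[/eqP /st_h[_ -> _]] /IH.
  rewrite /= (walk_lt _ _ walk) andbT.
  by case: (r d) walk => [|j s] /= /andP[/eqP /st_h[-> _ _]].
apply: (@odd_subdivision V _ (disjoint_pairs es) (h \o nth 9 hubs) (map h \o r)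
  (colors_trivial (c (+) flip)) odd_es) => [q d qes dq|q qes].
  have := walks d (pairs_es _ _ qes dq).
  by rewrite /= -map_rcons path_map; apply: sub_path => i j /eqP /st_h[_ _ /eqP].
have := disj q qes; rewrite -(@map_inj_in_uniq _ _ h).
  by rewrite map_cons map_cat map_cons !map_rcons.
apply: sub_in2 h_inj => i; rewrite -cat_cons mem_cat => /orP[] hi.
  by have /allP := bounded q.1 (pairs_es _ _ qes (mem_head _ _)); apply.
by have /allP := bounded q.2 (pairs_es _ _ qes (mem_last _ [:: _])); apply.
Qed.

Lemma occurs_coloring_of h flip (p : entry) : {in gtn 9 &, injective h} ->
  (forall d, d \in digit_pairs (red p) -> [/\ d.1 < 9, d.2 < 9 & e (h d.1) (h d.2) = ~~ flip]) ->
  (forall d, d \in digit_pairs (blue p) -> [/\ d.1 < 9, d.2 < 9 & e (h d.1) (h d.2) = flip]) ->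
  occurs h flip (coloring_of p).
Proof.
move=> h_inj; rewrite /coloring_of => h1 h0.
have foldP c s st : occurs h flip st ->
    (forall d, d \in s -> [/\ d.1 < 9, d.2 < 9 & e (h d.1) (h d.2) = c (+) flip]) ->
    occurs h flip (foldl (paint c) st s).
  elim: s st => //= -[i j] s IH st st_h hs; apply: IH => [|d ds].
    by have [i9 j9 eij] := hs _ (mem_head _ _); apply: occurs_paint.
  by apply: hs; rewrite inE ds orbT.
apply: (foldP) => [|d /h0 //]; apply: (foldP) => [|d /h1 //].
by split=> // i j c; rewrite /color_of !nth_nil.
Qed.

(** A copy of an impossible colouring is impossible: compose the placement of
    the points with the permutation, and the exchanges of colours. *)
Lemma refutes_avoided known st t :
  (forall k p, onth known k = Some p -> avoided (coloring_of p)) ->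
  refutes known st t -> avoided st.
Proof.
move=> known_avoided; elim: t st => [i j t1 IH1 t0 IH0|c u|c u|k b u] st /=.
- move=> /and4P[i9 j9 /IH1 av1 /IH0 av0] h flip st_h.
  case eij: (e (h i) (h j) (+) flip); [apply: (av1 h flip)|apply: (av0 h flip)];
  by apply: occurs_paint => //; rewrite -eij addbK.
- exact: subdivides_avoided K33_odd.
- exact: subdivides_avoided K5_odd.
case kp: onth => [p|//] /and5P[/eqP s9 us /allP s_lt /allP reds /allP blues].
have sub_nth i : nth 9 (digits u) i < 9 -> i < 9.
  by move=> lt9; rewrite -s9 ltnNge; apply: contraTN lt9 => /(nth_default 9) ->.
move=> h flip [h_inj st_h]; apply: (known_avoided _ _ kp (h \o nth 9 (digits u)) (b (+) flip)).
apply: occurs_coloring_of => [i j /= i9 j9 /h_inj|d /reds/eqP/st_h|d /blues/eqP/st_h].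
- move=> hij; have := hij (s_lt _ (mem_nth 9 _)) (s_lt _ (mem_nth 9 _)).
  by rewrite s9 => /(_ i9 j9) /eqP; rewrite nth_uniq ?s9 // => /eqP.
- by move=> [/sub_nth lt1 /sub_nth lt2 /= ->]; rewrite addNb.
- by move=> [/sub_nth lt1 /sub_nth lt2 /= ->].
Qed.

Lemma valid_avoided known es root :
  (forall k p, onth known k = Some p -> avoided (coloring_of p)) ->
  valid known es root -> avoided [::].
Proof.
elim: es known => [|p es IH] known av /=; first exact: refutes_avoided.
by move=> /andP[/(refutes_avoided av) av_p]; apply: IH => -[|k] q; [case=> <-|exact: av].
Qed.

End Soundness.

Definition no_pair := Number.UIntDecimal Decimal.Nil.

(** By and large from big colourings, refuted after few decisions, to small ones,
    which branch into copies of the previous ones. *)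
Definition catalogue : seq entry := [::
Entry 03132304142405152758 34254536564757674868 (On 2 8 (K33 true 01234588) (On 7 8 (K33 true 0123458788) (K5
  false 456781362)));
Entry 02122305153537 34453656475767485868 (On 7 8 (On 0 7 (On 1 7 (K33 true 013257) (On 1 8 (K33 true
  01325758) (K5 false 456781391))) (On 0 8 (On 1 8 (K33 true 01325887) (On 1 7 (K33 true 01325728) (K5 false
  456781391))) (K5 false 456781390))) (K5 false 4567813));
Entry 021203132304142405153537 3445365647674868 (On 2 5 (K33 true 012345) (On 2 7 (On 5 7 (K33 true 01234587)
  (On 5 8 (Earlier 1 false 012345678) (Earlier 0 false 012345678))) (On 2 8 (On 5 8 (K33 true 01234588) (On 7
  8 (On 5 7 (K33 true 0123458887) (Earlier 0 false 012345678)) (K5 false 456781352))) (K33 false 246578))));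
Entry 031323041424051828 34154536561747674868 (On 0 8 (K33 true 012348) (On 5 8 (K33 true 01234825) (On 7 8
  (Earlier 2 false 120348657) (K5 false 456781351))));
Entry 03132304142418 341525453656174767284868 (On 2 7 (On 7 8 (On 0 7 (K33 true 01234758) (On 0 8 (K33 true
  01234887) (K5 false 4567813516290))) (K5 false 45678135162)) (K33 false 246578));
Entry 03132304142405 3415254536561747674868 (On 1 8 (On 2 8 (Earlier 1 false 012345678) (Earlier 0 false
  012345678)) (K33 false 146578));
Entry 010203132304142405351737 34152545365647674868 (On 2 7 (Earlier 3 false 120347658) (Earlier 0 false
  021345678));
Entry 010212031323041424053537 3445365647674868 (On 1 5 (Earlier 4 false 012345678) (On 2 5 (Earlier 4 false
  021345678) (On 1 7 (Earlier 0 false 012345678) (Earlier 1 false 012345678))));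
Entry 010212031323041424354637 34453656 (On 4 7 (K5 true 0123497) (On 6 7 (K5 true 012349796) (On 4 8 (On 3 8
  (K5 true 0123498) (On 5 8 (K5 true 012349598) (On 7 8 (K5 true 012349798) (K33 false 357468)))) (On 6 8 (On
  3 8 (K5 true 012349896) (On 5 8 (K5 true 01234959896) (On 7 8 (K5 true 01234979896) (K33 false 357468))))
  (On 0 5 (Earlier 0 false 012345678) (On 1 5 (Earlier 0 false 102345678) (On 2 5 (Earlier 0 false 201345678)
  (On 0 7 (Earlier 0 false 012347658) (On 0 8 (On 1 7 (Earlier 0 false 102347658) (On 1 8 (On 2 8 (K33 true
  012348) (Earlier 3 false 102345678)) (K33 false 146578))) (K33 false 046578))))))))));
Entry 03132304142478 34051545365607374767384868 (On 0 8 (On 1 8 (On 2 7 (K33 true 01234887) (On 2 8 (K33 true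
  012348) (K5 false 346784592))) (Earlier 4 false 201345678)) (K5 false 346784590));
Entry 010212031323041424354657 3445365637473848 (On 6 7 (K5 true 01234959796) (On 6 8 (On 5 8 (K5 true
  01234959896) (On 7 8 (K5 true 0123495979896) (K33 false 357468))) (On 7 8 (On 0 5 (Earlier 8 false
  120543678) (On 1 5 (Earlier 8 false 021543678) (On 0 7 (On 1 7 (On 2 7 (K33 true 012347) (On 2 8 (K33 true
  01234788) (K5 false 346784592))) (Earlier 0 false 102345678)) (Earlier 0 false 012345678)))) (K5 false
  3467845))));
Entry 03132304142478 3445365607374757384858 (On 0 8 (On 1 7 (On 2 7 (K33 true 01234728) (On 2 8 (K33 true
  01234857) (K5 false 345781692))) (On 1 8 (On 2 8 (K33 true 012348) (On 2 7 (K33 true 01234887) (K5 false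
  345781692))) (K5 false 345781691))) (K5 false 345781690));
Entry 0313230414240778 34453656374757384858 (On 1 7 (On 2 7 (K33 true 012347) (On 2 8 (K33 true 01234788) (K5
  false 345781692))) (Earlier 0 false 102345678));
Entry 0102120313230414243546 3445 (On 3 6 (K5 true 0123496) (On 5 6 (K5 true 012349596) (On 3 7 (Earlier 4
  false 012345678) (On 4 7 (Earlier 4 false 012436578) (On 3 8 (Earlier 4 false 012345687) (On 4 8 (Earlier 4
  false 012436587) (On 5 7 (Earlier 2 false 012345678) (On 5 8 (Earlier 2 false 012345687) (On 7 8 (On 0 7
  (Earlier 0 false 012345678) (Earlier 1 false 012345678)) (K5 false 3457816))))))))));
Entry 031323041424061627 2545264647574858 (On 6 7 (K33 true 01234687) (On 6 8 (On 2 8 (K33 true 01234688) (On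
  7 8 (K33 true 0123468788) (K33 false 247568))) (Earlier 12 false 013254678)));
Entry 0313230414240616 2545465647574858 (On 2 6 (K33 true 012346) (On 2 7 (Earlier 0 false 012345678) (On 2 8
  (Earlier 0 false 012345687) (K33 false 245678))));
Entry 031323041424061868 25451646561747574858 (On 2 6 (K33 true 01234658) (On 2 8 (K33 true 01234826) (On 7 8
  (On 2 7 (K33 true 0123482687) (K33 false 245678)) (K33 false 24756871))));
Entry 03132304142406 25451646561747574858 (On 1 8 (On 0 8 (Earlier 1 false 012345867) (On 6 8 (Earlier 0 false
  012345678) (On 0 7 (On 7 8 (Earlier 0 false 012345768) (K5 false 4567871)) (K5 false 456787190)))) (K33
  false 145678));
Entry 03132304142406 2545465647574858 (On 1 6 (Earlier 2 false 012345678) (On 1 7 (On 0 7 (Earlier 2 false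
  012345768) (On 0 8 (On 1 8 (Earlier 2 false 012345867) (Earlier 0 false 012345687)) (Earlier 0 false
  102345786))) (Earlier 0 false 012345678)));
Entry 031323041424 254506465647574858 (On 0 7 (Earlier 0 false 012345768) (On 0 8 (Earlier 0 false 012345867)
  (K33 false 045678)));
Entry 010212031323041424051535 45464748 (On 2 5 (K33 true 012345) (On 5 6 (Earlier 6 false 013254687) (On 5 7
  (Earlier 6 false 013254786) (On 5 8 (Earlier 6 false 013254876) (On 0 6 (Earlier 1 false 012345678) (Earlier
  0 false 012345678))))));
Entry 0102120313230414240506161727 3425452636464748 (On 0 7 (K33 true 012347) (On 5 7 (K33 true 01234725) (On
  3 7 (Earlier 0 false 120347568) (On 2 8 (On 6 8 (K33 true 01234688) (On 7 8 (On 0 8 (K33 true 01234728) (K33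
  false 3584674280)) (K33 false 35846742))) (Earlier 2 true 586421703)))));
Entry 01021203132304142405061627 341525452636464748 (On 6 7 (K33 true 01234687) (On 1 7 (Earlier 0 false
  012345678) (On 1 8 (On 2 8 (Earlier 0 false 012345687) (On 7 8 (On 0 7 (K33 true 01234758) (On 0 8 (K33 true
  01234887) (K33 false 2475686180))) (K33 false 24756861))) (Earlier 3 true 785410623))));
Entry 0212230535061618 3415254526364607172747082848 (On 3 7 (On 6 7 (On 5 8 (K33 true 0132564887) (K5 false
  24578067190)) (K33 false 2475686180)) (K33 false 247358067180));
Entry 010212132305351656071838 34152545263646172848 (On 7 8 (K33 true 0132582746) (On 3 7 (On 6 7 (K33 true
  036157) (K33 false 24756861)) (K33 false 2473580671)));
Entry 021223053506163718 1525452646172747284878 (On 6 7 (On 5 8 (K33 true 0132564887) (K5 false 245780671))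
  (K33 false 24756861));
Entry 021223053506165618 34152545263646172747283848 (On 3 7 (On 7 8 (On 0 7 (K33 true 0132574658) (On 0 8 (K33
  true 0132584687) (Earlier 2 false 012345678))) (Earlier 0 false 012345678)) (K33 false 234678));
Entry 010212132305350616 341525452636461727472848 (On 1 8 (On 5 6 (On 3 8 (On 0 8 (K33 true 01325846) (On 0 7
  (Earlier 2 false 012345678) (Earlier 3 false 012345678))) (Earlier 0 false 012345678)) (On 3 7 (On 6 7 (On 5
  8 (K33 true 0132564887) (K33 false 24567871)) (K5 false 245670881)) (K33 false 2354670881))) (K33 false
  124578));
Entry 010212031323041424053506161718 3425452636462737472848 (On 3 8 (On 0 8 (Earlier 7 false 012348567) (On 0
  7 (On 5 6 (On 5 7 (K33 true 015367) (On 7 8 (K33 true 0132574688) (K33 false 24735806))) (Earlier 2 false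
  132047865)) (Earlier 0 false 102348675))) (K33 false 234678));
Entry 01021203132304142405350616 34152545464748 (On 2 6 (K33 true 012346) (On 3 6 (Earlier 8 false 012346578)
  (On 2 7 (Earlier 6 false 012345678) (On 2 8 (Earlier 6 false 012345687) (On 1 7 (On 1 8 (On 3 7 (On 0 7
  (Earlier 8 false 012347568) (On 0 8 (On 3 8 (Earlier 8 false 012348567) (Earlier 0 false 102347685))
  (Earlier 1 false 102347685))) (Earlier 0 false 012345678)) (Earlier 1 false 012345687)) (Earlier 1 false
  012345678))))));
Entry 03132304142427 1525451626460717472848 (On 0 8 (On 1 8 (On 7 8 (K33 true 01234887) (K33 false 12456758))
  (K33 false 124568)) (K33 false 1245675850));
Entry 0112130535062728 341525451626461747571848 (On 6 7 (On 5 8 (On 3 6 (K33 true 0231564857) (On 3 7 (K33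
  true 0231572648) (K33 false 1354670872))) (K33 false 14567862)) (K5 false 145670872));
Entry 01021203130535062757672858 3415451607170848 (On 3 6 (K33 true 03715662) (On 3 7 (K33 true 0231572648)
  (On 6 8 (K33 true 07825613) (K33 false 1384670580))));
Entry 010212031323041424053506 34152545162646174748 (On 2 7 (On 0 7 (Earlier 3 false 021345768) (On 2 8 (On 0
  8 (Earlier 3 false 021345867) (On 1 8 (Earlier 13 true 567412038) (On 5 7 (On 5 8 (On 6 7 (Earlier 0 false
  012345678) (On 6 8 (Earlier 0 false 012345687) (K33 false 14657862))) (Earlier 1 false 012345687)) (Earlier
  1 false 012345678)))) (Earlier 2 false 012345678))) (K33 false 124567));
Entry 010212031323041424053506 34152545464748 (On 1 6 (Earlier 4 false 012345678) (On 2 6 (Earlier 4 false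
  021345678) (On 1 7 (On 0 7 (Earlier 4 false 012345768) (On 2 7 (On 5 7 (K33 true 01234725) (On 6 7 (K33 true
  01234726) (On 1 8 (On 0 8 (Earlier 4 false 012345867) (On 2 8 (On 5 8 (K33 true 01234825) (On 6 8 (K33 true
  01234826) (K5 false 456784190))) (K33 false 24756880))) (Earlier 0 false 012345687)))) (Earlier 0 false
  021345678))) (Earlier 0 false 012345678))));
Entry 0102031323053516 064607470848 (On 3 7 (Earlier 15 true 687403125) (On 3 8 (Earlier 15 true 678403125)
  (On 3 6 (On 1 7 (Earlier 15 true 786403125) (Earlier 16 true 786403125)) (K33 false 034678))));
Entry 0102120313230414240535 3445464748 (On 1 5 (Earlier 15 false 012345678) (On 2 5 (Earlier 15 false
  021345678) (On 0 6 (Earlier 1 false 012345678) (On 0 7 (Earlier 1 false 012345768) (On 0 8 (Earlier 1 false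
  012345867) (On 1 6 (Earlier 0 false 012345678) (On 1 7 (Earlier 0 false 012345768) (Earlier 5 false
  210346758))))))));
Entry 010212031323041424061627 34051525452636464748 (On 6 7 (K33 true 01234687) (On 3 7 (Earlier 0 false
  201347568) (On 6 8 (On 2 8 (K33 true 01234688) (On 7 8 (K33 true 0123468788) (On 0 7 (On 1 7 (K33 true
  012347) (K33 false 24756861)) (K33 false 24756860)))) (On 5 6 (On 5 7 (K33 true 0123468785) (On 7 8 (On 5 8
  (K33 true 012346878885) (Earlier 35 false 013254678)) (K33 false 35846742))) (Earlier 1 true 457638012)))));
Entry 021203132335061656370818 05254526460727472848 (On 5 8 (K33 true 015368) (On 7 8 (K33 true 0132687587)
  (K5 false 245780670)));
Entry 021223350616370818 0525452646560727472848 (On 6 7 (On 5 8 (K33 true 0132687785) (K33 false 24567870))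
  (K5 false 245670880));
Entry 010212031323041424350616 34051525452636460727472848 (On 0 8 (On 3 8 (Earlier 3 false 012348567) (On 3 7
  (On 1 7 (Earlier 3 false 102347568) (On 1 8 (On 5 6 (Earlier 1 false 012345678) (Earlier 0 false 012345678))
  (K33 false 124578))) (K33 false 234678))) (K33 false 024578));
Entry 010212031323041424350616 340515254536464748 (On 2 6 (K33 true 012346) (On 2 7 (Earlier 3 false
  012345678) (On 2 8 (Earlier 3 false 012345687) (On 0 7 (On 1 7 (On 3 7 (Earlier 20 false 012347568) (On 3 8
  (On 0 8 (Earlier 4 false 012348567) (Earlier 0 false 012345687)) (K33 false 234678))) (Earlier 0 false
  102345678)) (Earlier 0 false 012345678)))));
Entry 0102120313230414243506 340515254516263646174748 (On 2 7 (On 3 7 (Earlier 5 false 201347568) (On 0 7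
  (Earlier 0 false 021345768) (On 1 8 (On 0 8 (Earlier 6 false 123048756) (Earlier 11 false 210345768)) (K33
  false 135467087280)))) (K33 false 124567));
Entry 0102120313230414243506 3405152545464748 (On 3 6 (Earlier 6 false 012346578) (On 1 6 (Earlier 1 false
  012345678) (On 2 6 (Earlier 1 false 021345678) (On 1 7 (On 2 7 (On 3 7 (Earlier 22 false 120347568) (Earlier
  1 false 120345768)) (Earlier 0 false 021345678)) (Earlier 0 false 012345678)))));
Entry 01021203132304142435 34 (On 4 5 (K5 true 0123495) (On 4 6 (Earlier 30 false 012345678) (On 4 7 (Earlier
  30 false 012345786) (On 4 8 (Earlier 30 false 012345876) (On 0 5 (Earlier 7 false 012345678) (On 1 5
  (Earlier 7 false 102345678) (On 2 5 (Earlier 7 false 201345678) (On 0 6 (Earlier 0 false 012345678) (On 1 6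
  (Earlier 0 false 102345678) (On 0 7 (Earlier 0 false 012345768) (On 1 7 (Earlier 0 false 102345768) (K33
  false 014567))))))))))));
Entry 0313230414240515 25354526364637473848 (On 2 7 (On 5 7 (K33 true 01234587) (On 2 8 (On 5 8 (K33 true
  01234588) (K33 false 34567862)) (K33 false 234568))) (K33 false 234567));
Entry 0313230414240515 3545364637473848 (On 2 5 (K33 true 012345) (On 2 6 (On 5 6 (K33 true 01234586) (On 2 7
  (On 5 7 (K33 true 01234587) (On 2 8 (On 5 8 (K33 true 01234588) (K33 false 345678)) (K33 false 34567882)))
  (Earlier 0 false 012345768))) (Earlier 0 false 012345678)));
Entry 031323041424 341525354516364637473848 (On 1 7 (On 0 7 (Earlier 0 false 012347568) (On 2 7 (Earlier 0
  false 120347568) (On 0 6 (On 2 6 (On 6 7 (K33 true 01234657) (K5 false 345677182)) (K33 false 234567)) (K5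
  false 34567718290)))) (K33 false 134567));
Entry 03132304142405 343545364637473848 (On 1 5 (Earlier 1 false 012345678) (On 2 5 (Earlier 1 false
  021345678) (On 1 6 (On 2 6 (Earlier 1 false 120346578) (Earlier 0 false 021345678)) (Earlier 0 false
  012345678))));
Entry 031323041424 34053545364637473848 (On 1 5 (Earlier 0 false 102345678) (On 0 6 (Earlier 0 false
  012346578) (Earlier 1 false 201345678)));
Entry 010212031323041424 no_pair (On 3 4 (K5 true 01234) (On 3 5 (Earlier 5 false 012345678) (On 4 5 (Earlier
  5 false 012435876) (On 3 6 (Earlier 5 false 012346875) (On 4 6 (Earlier 5 false 012436875) (On 3 7 (Earlier
  5 false 012347865) (On 4 7 (Earlier 5 false 012437865) (On 3 8 (Earlier 5 false 012348765) (On 4 8 (Earlier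
  5 false 012438765) (On 0 5 (Earlier 1 false 012345678) (Earlier 0 false 012345678)))))))))));
Entry 0313041405150616071767 24342535263646562737475728 (On 3 8 (On 4 8 (Earlier 38 false 018342567) (On 5 8
  (On 6 8 (K33 true 018356) (On 7 8 (K33 true 018357) (K33 false 23645788))) (K5 false 234560778))) (K5 false
  234560877));
Entry 02120313041405150616274778 24342526375767 (On 3 8 (K33 true 01723478) (On 5 8 (K33 true 01724588) (On 6
  8 (K33 true 01724688) (K33 false 27835604))));
Entry 02120313230414051506162747 243425352636465637 (On 5 7 (K33 true 017245) (On 6 7 (K33 true 017246) (On 7
  8 (Earlier 0 false 012345678) (On 2 8 (On 5 8 (K33 true 0123457788) (On 6 8 (K33 true 0123467788) (Earlier 2
  true 567384210))) (K33 false 23645728)))));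
Entry 0102120313230414051506160727 2434253526364656 (On 3 7 (Earlier 3 false 023178654) (On 4 7 (Earlier 0
  false 012345678) (On 5 7 (Earlier 0 false 012354678) (On 6 7 (On 7 8 (Earlier 1 false 012364578) (On 6 8 (On
  3 8 (K5 true 012368798) (Earlier 18 true 745318206)) (K33 false 23745688))) (K33 false 237456)))));
Entry 0102120313230414051545061607 2434253526364656 (On 2 7 (Earlier 0 false 012345678) (On 3 7 (Earlier 0
  false 013245678) (On 6 7 (On 4 7 (Earlier 0 false 014523678) (On 5 7 (Earlier 0 false 015423678) (On 7 8 (On
  2 8 (On 4 8 (K33 true 01824687) (On 5 8 (K33 true 01825687) (K5 false 234560778))) (On 3 8 (On 4 8 (K33 true
  01834687) (On 5 8 (K33 true 01835687) (K5 false 234560778))) (K5 false 234560877))) (Earlier 3 false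
  017645238)))) (K33 false 236457))));
Entry 01021203132304140515061627 24342535263646560708 (On 3 7 (On 4 7 (K33 true 017234) (On 5 7 (K33 true
  017235) (On 6 7 (K33 true 017236) (K33 false 237456)))) (On 4 7 (Earlier 2 false 012345678) (On 5 7 (Earlier
  2 false 012354678) (On 6 7 (On 6 8 (On 3 8 (K5 true 012368798) (On 2 8 (On 4 8 (K33 true 0123467887) (On 5 8
  (K33 true 0123567887) (K33 false 27834506))) (K5 false 234560877))) (K33 false 2374568088)) (K33 false
  237456)))));
Entry 01021203132304140515450616 24342535 (On 2 6 (Earlier 6 false 012368754) (On 3 6 (Earlier 6 false
  013268754) (On 4 6 (Earlier 6 false 014568732) (On 5 6 (Earlier 6 false 015468732) (On 0 7 (Earlier 1 false
  012345678) (On 0 8 (Earlier 1 false 012345687) (On 2 7 (Earlier 0 false 012345678) (On 3 7 (Earlier 0 false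
  013245678) (On 6 8 (On 4 7 (Earlier 0 false 014523678) (On 5 7 (Earlier 0 false 015423678) (On 2 8 (Earlier
  44 false 018263745) (On 3 8 (On 4 8 (K33 true 018346) (On 5 8 (K33 true 018356) (K5 false 234560778))) (K5
  false 234560877))))) (K33 false 2364578880))))))))));
Entry 021203130414051526463768 24342536564767 (On 3 8 (K33 true 01623478) (On 5 8 (K33 true 01624588) (On 7 8
  (K33 true 0162347877) (K33 false 35746832))));
Entry 011203132304140515062646 24342535365647576768 (On 2 8 (On 5 8 (K33 true 0123457688) (Earlier 23 true
  637518402)) (K33 false 23745628));
Entry 010212031323041405154506264637 243425353656 (On 4 7 (K5 true 012348697) (On 5 7 (K5 true 01234869795)
  (On 6 7 (K33 true 01623477) (On 6 8 (Earlier 1 false 012345678) (Earlier 0 false 012345678)))));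
Entry 01121406264607 24342516365617385878 (On 2 7 (On 4 7 (K33 true 024167) (K33 false 3574683271)) (K33 false
  2683570451));
Entry 01021203132304140626460718 243425351636561737573858 (On 7 8 (On 2 7 (K33 true 0123475876) (On 2 8 (K33
  true 0123482776) (On 6 8 (K33 true 01624827) (K5 false 23567042891)))) (Earlier 0 false 012345678));
Entry 0102120313230414051545062646 243425351636561737573858 (On 1 8 (On 0 8 (Earlier 5 false 012345876) (On 0
  7 (Earlier 0 false 012345678) (On 2 7 (On 4 7 (On 6 8 (K33 true 0123465877) (K5 false 3567804027190)) (K33
  false 357468327180)) (K33 false 268357045180)))) (K33 false 135678));
Entry 0313230414062617 24342535365607273757083858 (On 6 7 (On 2 8 (On 4 8 (K33 true 0123465778) (K33 false
  23845780)) (K5 false 235780490)) (K33 false 2683570480));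
Entry 0102120313230414051545062646 243425351636 (On 5 6 (K33 true 016245) (On 3 7 (Earlier 4 false 012345678)
  (On 5 7 (Earlier 4 false 014523678) (On 3 8 (Earlier 4 false 012345687) (On 5 8 (Earlier 4 false 014523687)
  (On 1 7 (On 0 7 (Earlier 7 false 012345786) (On 1 8 (On 0 8 (Earlier 7 false 012345876) (On 2 7 (On 4 7
  (Earlier 2 false 102345786) (Earlier 0 false 014523678)) (Earlier 0 false 012345678))) (Earlier 1 false
  012345687))) (Earlier 1 false 012345678)))))));
Entry 0102120313230414051545062607 2434253516364656 (On 1 7 (Earlier 8 false 012345786) (On 2 7 (On 3 7
  (Earlier 15 false 023178654) (On 4 7 (Earlier 0 false 012345786) (On 5 7 (Earlier 0 false 012354786) (K5
  false 345674291)))) (On 3 7 (On 4 7 (Earlier 0 false 013245786) (On 5 7 (Earlier 0 false 013254786) (On 1 8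
  (On 6 8 (On 3 8 (K33 true 028136) (On 7 8 (K33 true 02813677) (K33 false 2364575881))) (On 2 8 (On 7 8 (K33
  true 038127) (On 3 8 (On 4 8 (K33 true 018234) (On 5 8 (K33 true 018235) (K33 false 2384562721))) (K33 false
  2364575881))) (K33 false 2374562881))) (On 2 8 (On 3 8 (On 4 8 (K33 true 018234) (On 5 8 (K33 true 018235)
  (K33 false 1452380716))) (K33 false 1452360718)) (K33 false 1452370816))))) (K33 false 23645781))));
Entry 0102120313230414062617 243425351636465607273708 (On 6 7 (On 1 8 (On 6 8 (On 3 8 (K5 true 012366798) (On
  2 8 (Earlier 65 true 453712608) (Earlier 39 false 102637485))) (K33 false 2364578880)) (K33 false
  236457818880)) (K33 false 236457));
Entry 0102120313230414051545062617 24342535163646560708 (On 3 7 (On 6 7 (K33 true 027136) (On 2 7 (Earlier 17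
  false 123078654) (On 3 8 (On 4 7 (Earlier 2 false 103245786) (On 5 7 (Earlier 2 false 103254786) (On 1 8
  (Earlier 32 false 302178456) (On 2 8 (On 4 8 (K33 true 018234) (On 5 8 (K33 true 018235) (K33 false
  2384575680))) (K33 false 237458565180))))) (K33 false 2364575850)))) (On 2 7 (On 4 7 (Earlier 2 false
  102345786) (On 5 7 (Earlier 2 false 102354786) (On 1 8 (Earlier 1 false 102345786) (K5 false
  3456742919890)))) (Earlier 0 false 012345678)));
Entry 021203132304140515373848 2434351636172718 (On 5 7 (K33 true 0132457887) (On 2 8 (K33 true 018234) (On 5
  8 (K33 true 018345) (K33 false 1253780634))));
Entry 021203132304140515 24342535163646560717270818 (On 3 7 (On 3 8 (On 4 8 (Earlier 0 false 012345678) (On 5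
  8 (Earlier 0 false 012354678) (K33 false 238457565180))) (K33 false 236457585081)) (K33 false 23645781));
Entry 0102120313230414051526274728 16561718 (On 5 7 (K33 true 017245) (On 5 8 (K33 true 0123457788) (Earlier
  35 false 123054678)));
Entry 010212031323041405152627 243425351636465607170818 (On 2 8 (On 4 7 (Earlier 0 false 012345678) (On 5 7
  (Earlier 0 false 012354678) (On 3 8 (On 4 8 (K33 true 018234) (On 5 8 (K33 true 018235) (K33 false
  14537806))) (K5 false 3456738304291)))) (Earlier 1 false 012345687));
Entry 01021203132304140515450626 2434253516 (On 3 6 (Earlier 22 false 023168754) (On 4 6 (Earlier 7 false
  012345678) (On 5 6 (Earlier 7 false 012354687) (On 0 7 (Earlier 6 false 012345678) (On 0 8 (Earlier 6 false
  012345687) (On 1 7 (Earlier 4 false 012345678) (On 1 8 (Earlier 4 false 012345687) (On 2 7 (Earlier 0 false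
  012345678) (Earlier 2 false 012345678)))))))));
Entry 010212031323041405154507 24342535164656 (On 1 7 (Earlier 16 false 012345786) (On 2 7 (Earlier 0 false
  012345786) (On 3 7 (Earlier 0 false 013245786) (K33 false 23645781))));
Entry 010212031323041405154517 243425351646560708 (On 2 7 (Earlier 1 false 102345786) (On 3 7 (Earlier 1 false
  103245786) (On 1 8 (Earlier 0 false 104523786) (K33 false 236457818880))));
Entry 010212031323041405154506 24342535 (On 1 6 (Earlier 18 false 012345678) (On 2 6 (Earlier 2 false
  012345678) (On 3 6 (Earlier 2 false 013245687) (On 4 6 (Earlier 2 false 014523687) (On 5 6 (Earlier 2 false
  015423687) (On 0 7 (Earlier 1 false 012345678) (On 0 8 (Earlier 1 false 014523687) (On 1 7 (Earlier 0 false
  012345678) (On 1 8 (Earlier 0 false 014523687) (On 2 7 (On 3 7 (On 4 7 (K33 true 017234) (On 5 7 (K33 true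
  017235) (K33 false 23745681))) (Earlier 5 false 013245678)) (Earlier 5 false 012345678)))))))))));
Entry 0102120313230414051545 24342535 (On 0 6 (Earlier 0 false 012345678) (On 1 6 (Earlier 0 false 102345687)
  (On 0 7 (Earlier 0 false 012345786) (On 1 7 (Earlier 0 false 102345786) (On 0 8 (Earlier 0 false 012345876)
  (On 1 8 (Earlier 0 false 102345876) (On 2 6 (Earlier 27 true 678012345) (Earlier 28 true 678012345))))))));
Entry 010212031323041405150616 2434253545 (On 2 6 (Earlier 27 false 012368754) (On 3 6 (Earlier 27 false
  013268754) (On 4 6 (Earlier 0 false 012346875) (On 5 6 (Earlier 0 false 012356874) (Earlier 27 true
  456238710)))));
Entry 031323041405152646 24342535362747674868 (On 2 8 (On 5 8 (K33 true 0123457688) (K33 false 23845627)) (K33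
  false 24637805));
Entry 0102120313230414051506264637 243425353656 (On 4 7 (K5 true 012348697) (On 6 7 (K33 true 01623477) (On 6
  8 (Earlier 21 false 012345678) (On 5 7 (On 2 7 (K33 true 0123457687) (On 7 8 (Earlier 21 false 015432768)
  (On 4 8 (On 3 8 (K5 true 012348698) (On 5 8 (K5 true 0123486979598) (K33 false 35746832))) (Earlier 0 false
  012345678)))) (Earlier 20 false 012345678)))));
Entry 021203132304140515264657 2434254536563738 (On 2 7 (K33 true 0123457687) (On 6 7 (K33 true 01624587) (On
  2 8 (On 5 8 (K33 true 0123457688) (On 7 8 (K33 true 012345768887) (K33 false 26835704))) (Earlier 1 false
  016435278))));
Entry 01021203132304140515062646 24342535451636 (On 5 6 (K33 true 016245) (On 3 7 (Earlier 1 false 012345678)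
  (On 3 8 (Earlier 1 false 012345687) (On 5 7 (Earlier 0 false 012345678) (On 5 8 (Earlier 0 false 012345687)
  (On 1 7 (On 0 7 (Earlier 3 false 012345786) (On 1 8 (On 0 8 (Earlier 3 false 012345876) (On 2 7 (Earlier 54
  false 103257486) (Earlier 17 false 012345678))) (Earlier 54 false 013256487))) (Earlier 54 false
  013256478)))))));
Entry 010212031323041405152607 243425354516364656 (On 1 7 (Earlier 4 false 012345786) (On 2 7 (On 3 7 (Earlier
  32 false 023178654) (On 4 7 (Earlier 0 false 012345786) (On 5 7 (Earlier 0 false 012354786) (K5 false
  345674291)))) (On 3 7 (On 4 7 (Earlier 0 false 013245786) (On 5 7 (Earlier 2 false 013254768) (On 6 7
  (Earlier 5 true 452736810) (Earlier 32 true 456378210)))) (K33 false 23645781))));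
Entry 01021203132304140515062617 2434253545163646560708 (On 3 7 (On 6 7 (K33 true 027136) (On 2 7 (Earlier 33
  false 123078654) (On 4 7 (Earlier 1 false 103245786) (On 5 7 (Earlier 3 false 103254768) (Earlier 33 true
  456378210))))) (On 2 7 (On 4 7 (Earlier 1 false 102345786) (On 5 7 (Earlier 1 false 102354786) (Earlier 33
  true 345678210))) (Earlier 16 false 012345678)));
Entry 010212031323041405150626 243425354516 (On 3 6 (Earlier 34 false 023168754) (On 4 6 (Earlier 2 false
  012345678) (On 5 6 (Earlier 2 false 012354687) (On 0 7 (Earlier 1 false 012345678) (On 0 8 (Earlier 1 false
  012345687) (On 1 7 (Earlier 0 false 012345678) (On 1 8 (Earlier 0 false 012345687) (On 2 7 (Earlier 12 false
  012345678) (Earlier 14 false 012345678)))))))));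
Entry 02120414051546566728 2434253526362737 (On 6 8 (K33 true 01624568) (On 7 8 (K33 true 0162456768) (On 4 8
  (On 5 8 (K33 true 018245) (K33 false 238567)) (K33 false 238467))));
Entry 04140515465617670868 2434162636273748 (On 1 8 (K33 true 016458) (On 7 8 (K33 true 01645728) (K33 false
  23846771)));
Entry 0102041405150646561767 2434253545162636072737283848 (On 4 7 (On 6 8 (On 0 8 (Earlier 0 false 012345678)
  (On 5 7 (On 1 8 (K5 true 014566877) (K33 false 2384677180)) (K5 false 23457068880))) (Earlier 76 true
  238641507)) (K33 false 234578));
Entry 0102041405150646561767 243425354516263627372838 (On 0 7 (K33 true 016457) (On 4 8 (On 5 8 (K5 true
  014566778) (Earlier 0 false 012354678)) (Earlier 0 false 012345678)));
Entry 0102120313230414051506465667 2434253545162636 (On 2 7 (K33 true 01624567) (On 3 7 (K33 true 01634567)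
  (On 2 8 (Earlier 3 false 012345678) (On 3 8 (Earlier 3 false 013245678) (On 1 7 (Earlier 0 false 012345678)
  (On 1 8 (On 0 8 (Earlier 11 false 012345876) (On 6 8 (Earlier 0 false 012345687) (On 0 7 (On 7 8 (K33 true
  01645758) (K5 false 236780471)) (K5 false 23678047190)))) (K33 false 123678)))))));
Entry 01141506465657 24342535263647675868 (On 4 8 (On 7 8 (On 0 7 (K33 true 04516758) (On 0 8 (K33 true
  04516887) (K33 false 2374567078))) (K33 false 23745678)) (K33 false 238456));
Entry 01021203132304140515572858 24253526476768 (On 3 7 (K5 true 012358897) (On 3 8 (K33 true 018235) (On 4 8
  (K33 true 018245) (K33 false 27834605))));
Entry 01021203132304140515064656 24342535452636476768 (On 5 7 (On 5 8 (On 2 8 (Earlier 0 false 012345678) (On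
  3 8 (Earlier 0 false 013245678) (On 4 8 (On 7 8 (On 0 7 (K33 true 04516758) (On 0 8 (K33 true 045168) (K33
  false 23746880))) (K33 false 237468)) (K33 false 23456877)))) (Earlier 1 false 012345678)) (K33 false
  237456));
Entry 01021203132304140515064656 2434253545162636 (On 6 7 (Earlier 3 false 012345678) (On 6 8 (Earlier 3 false
  012345687) (On 4 7 (On 5 7 (On 0 7 (K33 true 045167) (On 2 7 (K33 true 017245) (On 3 7 (K33 true 017345) (On
  4 8 (On 0 8 (Earlier 6 false 052361478) (On 5 8 (Earlier 79 false 450167823) (K33 false 23856780))) (Earlier
  0 false 012345687))))) (Earlier 0 false 012354678)) (Earlier 0 false 012345678))));
Entry 0102120313230414051507 243425354516263656 (On 1 7 (Earlier 16 false 012345786) (On 2 7 (Earlier 9 false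
  012345786) (On 3 7 (Earlier 9 false 013245786) (On 5 7 (On 4 7 (Earlier 0 false 012345786) (On 1 8 (On 0 8
  (Earlier 16 false 012345876) (On 2 8 (Earlier 9 false 102345876) (On 3 8 (Earlier 9 false 103245876) (K5
  false 23456088781)))) (Earlier 8 true 671023458))) (K33 false 235467)))));
Entry 01021203132304140515064617 2434253545162636560708 (On 2 7 (Earlier 10 false 102345786) (On 3 7 (Earlier
  10 false 103245786) (On 5 7 (On 5 8 (On 4 7 (Earlier 1 false 102345786) (On 1 8 (Earlier 0 false 102354786)
  (On 4 8 (On 6 7 (K33 true 04715648) (On 2 8 (K33 true 018245) (On 3 8 (K33 true 018345) (K5 false
  234560887)))) (K5 false 23456078881)))) (K33 false 2354678880)) (K33 false 235467))));
Entry 01021203132304140515572858 2425351626174718 (On 3 7 (K5 true 012358897) (On 3 8 (K33 true 018235) (On 4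
  8 (K33 true 018245) (K33 false 1342780635))));
Entry 01021203132304140515 2434253545162636560717470818 (On 5 7 (On 5 8 (On 2 8 (Earlier 0 false 012345678)
  (On 3 8 (Earlier 0 false 013245678) (K5 false 23456088781))) (K33 false 237456707881)) (K33 false 23745681));
Entry 01021203132304140515274748 243425451626365607170818 (On 3 7 (K33 true 017234) (On 5 7 (K33 true 017245)
  (On 2 8 (On 3 8 (K5 true 012348798) (On 5 8 (K33 true 018245) (K33 false 1352780634))) (K33 false
  2354672820))));
Entry 010212031323041405150646 2434253545162636 (On 5 6 (Earlier 5 false 012345678) (On 0 7 (Earlier 4 false
  012345678) (On 0 8 (Earlier 4 false 012345687) (On 1 7 (Earlier 3 false 012345678) (On 1 8 (Earlier 3 false
  012345687) (On 4 7 (On 4 8 (On 2 7 (Earlier 0 false 012345678) (On 3 7 (Earlier 0 false 013245678) (Earlier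
  13 true 671023458))) (Earlier 1 false 012345687)) (Earlier 1 false 012345678)))))));
Entry 0102120313230414051506 2434253545 (On 1 6 (Earlier 22 false 012345678) (On 2 6 (Earlier 15 false
  012345678) (On 3 6 (Earlier 15 false 013245687) (On 4 6 (Earlier 0 false 012345678) (On 5 6 (Earlier 0 false
  012354687) (Earlier 50 true 456238710))))));
Entry 01021203132304140515 2434 (On 2 5 (Earlier 51 false 012358764) (On 3 5 (Earlier 51 false 013258764) (On
  4 5 (Earlier 24 false 012345678) (On 0 6 (Earlier 0 false 012345678) (On 1 6 (Earlier 0 false 102345687) (On
  0 7 (Earlier 0 false 012345786) (On 1 7 (Earlier 0 false 102345786) (On 0 8 (Earlier 0 false 012345876) (On
  1 8 (Earlier 0 false 102345876) (On 2 6 (Earlier 52 true 678012345) (Earlier 53 true 678012345)))))))))));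
Entry 01021203132304142545363748 343546564757 (On 3 8 (K5 true 012348598) (On 6 8 (K5 true 01234859698) (On 7
  8 (K5 true 01234859798) (K33 false 367458))));
Entry 0102120313230414254506 2434153516264656071747574858 (On 1 8 (On 0 8 (Earlier 1 false 012348765) (On 2 8
  (On 6 8 (K33 true 0123482675) (K33 false 1485673380)) (K33 false 148257064380))) (K33 false 145678));
Entry 01021203132314052545061737 24341535162646560747574858 (On 2 7 (Earlier 54 false 123078654) (Earlier 0
  false 021354678));
Entry 0102120313230414052545063637 24341535465647574858 (On 1 6 (Earlier 55 false 013268754) (On 2 6 (Earlier
  55 false 023168754) (On 0 7 (Earlier 3 false 031267854) (On 1 7 (Earlier 0 false 012345678) (Earlier 1 false
  012345678)))));
Entry 01021203132304140525453637 243415354656 (On 4 7 (K5 true 012348597) (On 5 7 (K33 true 01523477) (On 4 8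
  (Earlier 3 false 012345678) (On 5 8 (Earlier 3 false 021354678) (On 0 6 (Earlier 0 false 012345678) (On 0 7
  (Earlier 0 false 012345768) (On 0 8 (On 1 8 (Earlier 4 false 012348765) (On 2 8 (Earlier 4 false 021358764)
  (On 1 6 (Earlier 1 false 012345867) (Earlier 2 false 012345867)))) (K33 false 045678))))))));
Entry 0102120313230414254578 2434153526465607374757384858 (On 0 8 (On 1 7 (Earlier 46 true 657081423) (On 1 8
  (Earlier 5 false 012348765) (K33 false 13457866))) (K5 false 345784690));
Entry 010212031323041425450778 24341535264656374757384858 (On 1 7 (Earlier 6 false 012347865) (On 1 8 (Earlier
  47 true 657180423) (K33 false 13457866)));
Entry 010212031323041425453667 2434153546563738 (On 4 7 (K5 true 01234859697) (On 5 7 (K33 true 0152347776)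
  (On 6 8 (On 4 8 (K5 true 01234859698) (On 5 8 (K33 true 0152347876) (On 7 8 (On 2 6 (Earlier 108 false
  012643578) (On 0 7 (Earlier 0 false 012345678) (Earlier 1 false 012345678))) (K5 false 3457846)))) (On 7 8
  (On 4 8 (K5 true 0123485969798) (On 5 8 (K33 true 015234787776) (On 2 6 (Earlier 108 false 012643578) (On 0
  7 (Earlier 0 false 012345678) (Earlier 1 false 012345678))))) (K33 false 367458)))));
Entry 0102120313230414052536 2434153546561737673868 (On 1 8 (On 2 6 (On 1 6 (Earlier 60 false 123068754) (On 2
  7 (On 0 7 (Earlier 8 false 021357864) (On 0 8 (Earlier 8 false 012348765) (On 4 7 (On 5 8 (K33 true
  0123455877) (K5 false 35678145190)) (K33 false 3674587180)))) (Earlier 83 false 023164578))) (Earlier 83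
  false 013265478)) (K33 false 136578));
Entry 010212031323041405254536 24341535 (On 4 6 (K5 true 012348596) (On 5 6 (K33 true 01523476) (On 3 7
  (Earlier 4 false 012345678) (On 3 8 (Earlier 4 false 012345687) (On 6 7 (Earlier 1 false 012345678) (On 6 8
  (Earlier 1 false 012345687) (On 1 7 (On 0 7 (Earlier 9 false 012347865) (On 2 7 (On 0 8 (On 1 8 (Earlier 9
  false 012348765) (Earlier 0 false 012345687)) (Earlier 0 false 102347685)) (Earlier 0 false 021354678)))
  (Earlier 0 false 012345678))))))));
Entry 0102120313230414052545172708 2434153516263767 (On 7 8 (K33 true 0123472875) (On 1 8 (Earlier 10 false
  012348765) (On 2 8 (On 4 8 (K33 true 024158) (K33 false 1473680542)) (K33 false 1273680534))));
Entry 0313230414052517 2434153516263607374767083868 (On 5 7 (On 2 8 (On 4 8 (K33 true 0123455778) (K5 false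
  346784290)) (K33 false 23746880)) (K33 false 367458324180));
Entry 031323041405251757 2434153516260737670818 (On 2 8 (On 4 8 (K33 true 0123455778) (K33 false
  147368054280)) (K33 false 127368053480));
Entry 0102031323041405250646561727475718 24341535162607376708 (On 5 8 (K33 true 0123455877) (Earlier 0 false
  054621378));
Entry 010212031323041405254527 24341535162636071737673868 (On 0 8 (On 1 8 (Earlier 14 false 012348765) (On 7 8
  (On 4 7 (K33 true 02415728) (On 4 8 (K33 true 02415857) (K33 false 13467862))) (K5 false 1367805))) (On 4 7
  (On 1 8 (On 5 8 (K33 true 0123455877) (K33 false 13856780)) (K5 false 136780590)) (K33 false 148367054280)));
Entry 010212031323041405254527 24341535162636560737673868 (On 1 7 (On 0 8 (Earlier 4 false 012345678) (On 4 7
  (On 5 7 (On 1 8 (Earlier 55 false 102346785) (Earlier 2 false 012345678)) (Earlier 3 false 021354678))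
  (Earlier 3 false 012345678))) (Earlier 0 false 012345678));
Entry 0102120313230414052545064627 243415351626363738 (On 6 7 (K33 true 02415657) (On 0 7 (Earlier 16 false
  021357864) (On 6 8 (On 2 8 (K33 true 02415658) (On 7 8 (K33 true 0241565758) (On 1 8 (On 5 8 (K33 true
  01524826) (K33 false 2573680441)) (K33 false 1273680534)))) (On 5 6 (On 1 7 (On 0 8 (Earlier 5 false
  012345678) (On 4 7 (On 5 7 (On 1 8 (Earlier 2 false 012345678) (Earlier 3 false 012345678)) (Earlier 4 false
  021354678)) (Earlier 4 false 012345678))) (Earlier 1 false 012345678)) (Earlier 0 false 012345678)))));
Entry 02120414254506 243415351626361727372838 (On 1 8 (On 5 8 (Earlier 116 false 015426378) (K33 false
  12356738)) (K33 false 123678));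
Entry 01021203132304140525450646 243415351626363738 (On 2 7 (Earlier 1 false 012345678) (On 2 8 (Earlier 1
  false 012345687) (On 1 7 (On 5 6 (Earlier 1 false 021354678) (On 0 7 (Earlier 18 false 012347865) (On 4 7
  (Earlier 114 false 015426378) (On 5 7 (On 6 7 (K33 true 01524726) (On 0 8 (On 7 8 (K33 true 01524728) (K33
  false 237468)) (K33 false 23746880))) (Earlier 115 false 051426378))))) (Earlier 0 false 012345678))));
Entry 01021203132304140525450607 2434153516263646563738 (On 1 7 (Earlier 19 false 012347865) (On 2 7 (Earlier
  19 false 021357864) (On 4 7 (Earlier 0 false 012345768) (On 2 8 (On 5 7 (Earlier 0 false 021354768) (On 1 8
  (On 6 8 (K33 true 0123482675) (On 7 8 (K33 true 0123482775) (K33 false 1283670534))) (K33 false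
  1253670834))) (K33 false 1243670538)))));
Entry 021203132304142545061767 2434153516263607370838 (On 2 7 (K33 true 0123472675) (On 5 7 (K33 true
  01524726) (On 6 8 (On 2 8 (K33 true 012346577588) (On 5 8 (K33 true 0152465788) (K33 false 23567861))) (K33
  false 258367044180))));
Entry 01021203132304140525450617 243415351626364607370838 (On 6 7 (Earlier 0 false 012345678) (On 6 8 (On 1 8
  (Earlier 0 false 012345687) (On 2 8 (On 4 8 (K33 true 02415826) (K33 false 147368054280)) (K33 false
  127368053480))) (Earlier 5 false 021354678)));
Entry 010212031323041405254506 24341535363738 (On 1 6 (Earlier 22 false 012346875) (On 2 6 (Earlier 22 false
  021356874) (On 4 6 (Earlier 3 false 012345678) (On 5 6 (Earlier 3 false 021354678) (On 0 7 (Earlier 2 false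
  012345678) (On 0 8 (Earlier 2 false 012345687) (On 1 7 (Earlier 0 false 012345678) (On 2 7 (Earlier 0 false
  021354678) (On 6 8 (On 1 8 (Earlier 1 false 012345687) (Earlier 119 false 024516378)) (K33 false
  128367053480))))))))));
Entry 03132304140525 24341535063646560717370838 (On 2 7 (On 4 7 (On 1 8 (On 5 8 (K33 true 0123455877) (K33
  false 03567871)) (K33 false 01357806)) (K33 false 0453670881)) (K33 false 045367085281));
Entry 01021203132304140525451626 24341535063607370838 (On 4 6 (On 5 6 (On 1 7 (Earlier 1 false 102346758) (On
  2 7 (Earlier 1 false 201356748) (On 1 8 (Earlier 1 false 102346857) (On 2 8 (On 4 8 (K33 true 0123455678)
  (K33 false 014378063572)) (K33 false 012378063564))))) (Earlier 125 true 783620451)) (On 5 6 (Earlier 125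
  true 783610542) (On 1 7 (On 2 7 (Earlier 24 false 120367854) (Earlier 0 false 021354678)) (Earlier 0 false
  012345678))));
Entry 010212031323041405254516 24341535063607370838 (On 2 6 (Earlier 0 false 012345678) (On 5 6 (Earlier 126
  true 783610524) (On 1 7 (On 2 7 (Earlier 0 false 012345768) (On 5 7 (On 2 8 (On 4 8 (K33 true 0123455778)
  (K33 false 02346708)) (K33 false 023678)) (K33 false 0253670834))) (On 2 7 (On 4 7 (On 1 8 (On 5 8 (K33 true
  0123455877) (K33 false 03567871)) (K33 false 01357806)) (K33 false 045367084281)) (K33 false
  025367083481)))));
Entry 0102120313230414052545 24341535 (On 3 6 (Earlier 16 false 012345678) (On 3 7 (Earlier 16 false
  012345786) (On 3 8 (Earlier 16 false 012345876) (On 0 6 (Earlier 3 false 012345678) (On 0 7 (Earlier 3 false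
  012345768) (On 0 8 (Earlier 3 false 012345867) (On 1 6 (Earlier 0 false 012345678) (On 2 6 (Earlier 0 false
  021354678) (On 1 7 (Earlier 0 false 012345768) (On 2 7 (On 4 7 (On 1 8 (On 5 8 (K33 true 0123455877) (K33
  false 01356708)) (K33 false 013678)) (K33 false 014367083572)) (K33 false 012367083564)))))))))));
Entry 021203130414362848 243415451626172737 (On 3 8 (K33 true 018234) (On 6 8 (K33 true 01823476) (K33 false
  1234670578)));
Entry 0212031304142536 24341535451626465617273718 (On 4 8 (On 2 8 (Earlier 0 false 012345678) (On 3 8 (On 5 8
  (K33 true 01823465) (K33 false 1234570648)) (K33 false 12347805))) (K33 false 1234570846));
Entry 01021203132304140525063607 243415354516264656 (On 1 7 (Earlier 29 false 012347865) (On 2 7 (Earlier 29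
  false 021357864) (On 3 7 (Earlier 29 false 031267854) (On 1 8 (On 2 8 (On 6 8 (K33 true 038126) (On 3 8 (On
  4 8 (K33 true 018234) (On 7 8 (K5 true 0123837) (K33 false 1284670503))) (K33 false 1234670578))) (Earlier 0
  false 021354678)) (Earlier 0 false 012345678)))));
Entry 0102120313230414052506361757 24341535162646560708 (On 3 7 (K33 true 027135) (On 6 7 (K33 true 02713576)
  (On 2 7 (Earlier 3 false 201357864) (On 1 8 (On 3 8 (Earlier 97 false 302168457) (On 2 8 (On 4 8 (K33 true
  0123455778) (On 6 8 (K33 true 038126) (K33 false 238467454180))) (Earlier 41 false 104762358))) (Earlier 17
  false 012345678)))));
Entry 021203130414 2434153516260757670818 (On 2 8 (On 3 8 (On 4 8 (K33 true 018234) (K33 false 147568334280))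
  (K33 false 137568444280)) (K33 false 127568343380));
Entry 01021203132304140525063617 2434153545162646560708 (On 5 7 (Earlier 1 false 012345678) (On 6 7 (Earlier 1
  false 013246578) (On 1 8 (On 5 8 (Earlier 1 false 012345687) (On 6 8 (Earlier 1 false 013246587) (On 4 7 (On
  2 7 (Earlier 1 false 021354678) (On 2 8 (On 3 8 (On 4 8 (K33 true 018234) (K33 false 258467334180)) (K33
  false 258367044180)) (K33 false 25647833))) (Earlier 32 true 564718320)))) (Earlier 0 false 012345678))));
Entry 010212031323041405250636 24341535451626 (On 4 6 (Earlier 6 false 013246875) (On 5 6 (Earlier 6 false
  023156874) (On 0 7 (Earlier 3 false 012345678) (On 0 8 (Earlier 3 false 012345687) (On 1 7 (Earlier 0 false
  012345678) (On 2 7 (Earlier 0 false 021354678) (On 3 7 (Earlier 0 false 031264578) (On 1 8 (Earlier 0 false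
  012345687) (Earlier 4 false 012345678)))))))));
Entry 010212031323041425465637 2434153545162636 (On 4 7 (K5 true 01234858697) (On 5 7 (K33 true 0152347786)
  (On 6 7 (K33 true 0162346577) (On 3 8 (On 4 8 (K5 true 01234858698) (On 5 8 (K33 true 0152347886) (On 6 8
  (K33 true 0162346578) (K33 false 378456)))) (On 7 8 (On 4 8 (K5 true 0123485869798) (On 5 8 (K33 true
  015234787786) (On 6 8 (K33 true 016234657877) (K33 false 378456)))) (K5 false 34567385271))))));
Entry 0102120414052546562747 24341535451626360717371838 (On 2 8 (On 4 8 (On 0 8 (K33 true 02415876) (Earlier
  110 false 201437586)) (K33 false 13456872)) (K33 false 12346805));
Entry 010212031323041405254656 2434153545162636173738 (On 2 7 (On 4 7 (On 0 7 (K33 true 02415776) (On 1 8 (On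
  5 8 (K33 true 0123455877) (On 6 8 (K33 true 012345585677) (K33 false 1483560752))) (Earlier 0 false
  012345678))) (K33 false 13456772)) (K33 false 12346705));
Entry 0102120313230414052507 2434153545162636 (On 1 7 (Earlier 37 false 012347865) (On 2 7 (Earlier 37 false
  021357864) (On 3 7 (Earlier 3 false 012345786) (K33 false 12346705))));
Entry 010212031323041405250617 2434153545162636560708 (On 3 7 (On 5 7 (K33 true 027135) (On 2 7 (Earlier 90
  false 123078654) (On 3 8 (On 6 7 (Earlier 116 false 302157684) (On 1 8 (Earlier 38 false 130278654) (Earlier
  6 false 012345678))) (K33 false 235467585071)))) (On 2 7 (On 4 7 (Earlier 11 false 102347865) (On 1 8 (On 5
  7 (Earlier 11 false 201357864) (On 6 7 (On 2 8 (On 6 8 (K33 true 078126) (K5 false 3456752719890)) (K33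
  false 235467282071)) (K5 false 345675271))) (K33 false 134567282072))) (Earlier 73 false 012346578)));
Entry 01021203132304140525 24341535451626360717370818 (On 2 7 (On 4 7 (On 4 8 (On 3 8 (K5 true 012348798)
  (Earlier 114 false 201437586)) (K33 false 134567728880)) (K33 false 13456772)) (K33 false 12346705));
Entry 02120313041446273738 2434153516263607170818 (On 4 7 (K33 true 017234) (On 6 7 (K33 true 01723486) (On 2
  8 (On 4 8 (K33 true 018234) (On 6 8 (K33 true 01823486) (K33 false 14637805))) (K33 false 127468050380))));
Entry 010212031323041405250646 2434153545162636 (On 5 6 (On 3 7 (Earlier 6 false 012345678) (On 3 8 (Earlier 6
  false 012345687) (On 1 7 (On 0 7 (Earlier 41 false 012347865) (On 2 7 (On 4 7 (Earlier 14 false 102347865)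
  (On 5 7 (Earlier 14 false 201357864) (On 6 7 (On 1 8 (On 5 8 (K33 true 012345587776) (On 2 8 (On 4 8 (K33
  true 012345575678) (K33 false 3456783261)) (K33 false 23546871))) (Earlier 17 false 120374568)) (K5 false
  345675271)))) (Earlier 4 false 021354678))) (Earlier 4 false 012345678)))) (On 0 7 (Earlier 3 false
  012345678) (On 0 8 (Earlier 3 false 012345687) (On 1 7 (Earlier 2 false 012345678) (On 1 8 (Earlier 2 false
  012345687) (On 3 7 (On 3 8 (On 2 7 (Earlier 0 false 012345678) (On 2 8 (Earlier 0 false 012345687) (On 5 7
  (On 4 7 (K33 true 01723465) (On 6 7 (K33 true 0172346586) (K33 false 127468050380))) (Earlier 52 false
  306751248)))) (Earlier 1 false 012345687)) (Earlier 1 false 012345678)))))));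
Entry 0102120313230414052506 2434153545 (On 1 6 (Earlier 42 false 012346875) (On 2 6 (Earlier 42 false
  021356874) (On 3 6 (Earlier 8 false 012345678) (On 4 6 (Earlier 0 false 012345678) (On 5 6 (Earlier 0 false
  021354687) (On 0 7 (Earlier 4 false 012345678) (On 0 8 (Earlier 4 false 012345687) (On 1 7 (Earlier 3 false
  012345678) (On 2 7 (Earlier 3 false 021354678) (On 3 7 (On 3 8 (On 1 8 (Earlier 3 false 012345687) (On 2 8
  (Earlier 3 false 021354687) (On 4 7 (On 5 7 (K33 true 01723465) (On 4 8 (On 5 8 (K33 true 01823465) (K33
  false 1253780634)) (K33 false 1234560847))) (Earlier 53 false 306742158)))) (K33 false 123467058880)) (K33
  false 12346705)))))))))));
Entry 021203130414 243415350626560717270818 (On 2 8 (On 3 8 (On 4 8 (K33 true 018234) (K33 false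
  025467086381)) (K33 false 025367083481)) (K33 false 012578066463));
Entry 02120313041427 2434153506265607170818 (On 3 7 (On 4 7 (K33 true 017234) (On 2 8 (On 3 8 (On 4 8 (K33
  true 018234) (K33 false 0145780663)) (K33 false 045367084281)) (K33 false 025468076381))) (Earlier 0 false
  103246578));
Entry 010212031323041405251636 24341535060708 (On 5 6 (K33 true 026135) (On 2 6 (Earlier 97 false 123068754)
  (On 4 6 (Earlier 18 false 103246875) (On 1 7 (Earlier 2 false 103246785) (On 1 8 (Earlier 2 false 103246875)
  (On 2 7 (Earlier 0 false 012345678) (Earlier 1 false 012345678)))))));
Entry 010212031323041405251626 2434153506360708 (On 4 6 (Earlier 19 false 102346875) (On 5 6 (Earlier 19 false
  201356874) (On 1 7 (Earlier 3 false 102346785) (On 2 7 (Earlier 3 false 201356784) (On 3 8 (On 1 8 (Earlier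
  3 false 102346875) (On 2 8 (On 4 8 (K33 true 018234) (K33 false 014378063572)) (K33 false 012378063564)))
  (K33 false 045367085281))))));
Entry 0102120313230414052517 2434153545062636560708 (On 3 7 (Earlier 1 false 012345768) (On 2 7 (Earlier 0
  false 012345768) (Earlier 82 false 012346578)));
Entry 01021203132304140525165637 24341535450626360708 (On 5 7 (K5 true 012356697) (On 2 7 (Earlier 2 false
  021354768) (On 4 8 (On 2 8 (K33 true 0123455678) (On 3 8 (On 5 8 (K5 true 012356698) (K33 false 0253780634))
  (K33 false 0234680705))) (K33 false 0234670885))));
Entry 031323041405251656 24340626360727370838 (On 2 8 (On 4 8 (K33 true 0123455678) (K33 false 02346708)) (K33
  false 023678));
Entry 03132304140525165627 243406263607370838 (On 4 7 (K33 true 0123455677) (On 2 8 (On 4 8 (K33 true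
  0123455678) (K33 false 03467862)) (K33 false 02346807)));
Entry 0102120313230414052516 2434153545060708 (On 3 6 (Earlier 5 false 012345678) (On 2 6 (Earlier 4 false
  012345678) (On 5 6 (On 3 7 (Earlier 2 false 012345678) (On 3 8 (Earlier 2 false 012345687) (On 2 7 (Earlier
  0 false 012345678) (Earlier 1 false 012345678)))) (On 1 7 (Earlier 3 false 012345678) (On 1 8 (Earlier 3
  false 012345687) (On 2 7 (Earlier 6 false 012345678) (Earlier 7 false 012345678)))))));
Entry 01021203132304140525 243415 (On 3 5 (Earlier 104 false 023158764) (On 4 5 (Earlier 25 false 012345678)
  (On 0 6 (Earlier 9 false 012345678) (On 0 7 (Earlier 9 false 012345786) (On 0 8 (Earlier 9 false 012345876)
  (On 1 6 (Earlier 0 false 012345678) (On 2 6 (Earlier 0 false 021354678) (On 1 7 (Earlier 0 false 012345768)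
  (On 2 7 (Earlier 0 false 021354768) (On 3 8 (On 4 8 (On 5 8 (K33 true 01823465) (K33 false 012567086463))
  (K33 false 012467083533)) (K33 false 012367083564)))))))))));
Entry 021204142747 2434152535162636071748 (On 0 8 (On 1 8 (On 7 8 (K33 true 017248) (K33 false 1234560708))
  (K33 false 12345608)) (K33 false 123456070008));
Entry 01021203132304140545062747 243415253516263617 (On 3 7 (K33 true 017234) (On 0 7 (Earlier 1 false
  012347865) (On 4 8 (On 3 8 (K5 true 012348798) (On 1 8 (Earlier 142 true 567314208) (On 2 8 (On 5 7 (Earlier
  118 false 241035768) (Earlier 125 false 012435678)) (K33 false 123568)))) (Earlier 0 false 012345678))));
Entry 0102120313230414054506 243415253516263617 (On 4 7 (On 2 7 (Earlier 0 false 012345678) (On 3 7 (Earlier 0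
  false 013245678) (K33 false 123567))) (K33 false 12345607));
Entry 011405450618 243415253516263607273767082838 (On 4 6 (On 5 8 (On 6 8 (K33 true 048156) (K33 false
  23657861)) (K5 false 2356704718880)) (K33 false 23645771));
Entry 01140545061757671868 2434253507273708 (On 4 8 (K33 true 04715658) (On 5 8 (K33 true 078156) (K33 false
  23845780)));
Entry 0102120313230414054506 2434152535 (On 1 6 (Earlier 58 false 012346875) (On 2 6 (Earlier 5 false
  012346875) (On 3 6 (Earlier 5 false 013246875) (On 1 7 (On 0 7 (Earlier 58 false 012347865) (On 2 7 (Earlier
  5 false 102347865) (On 3 7 (Earlier 5 false 103247865) (On 1 8 (On 0 8 (Earlier 58 false 012348765) (On 2 8
  (Earlier 5 false 102348765) (On 3 8 (Earlier 5 false 103248765) (On 6 7 (On 6 8 (On 5 7 (Earlier 0 false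
  012345678) (On 4 7 (On 5 8 (K33 true 04815657) (K33 false 23567861)) (K33 false 23745880))) (Earlier 1 false
  012345687)) (Earlier 1 false 012345678))))) (Earlier 2 false 012345687))))) (Earlier 2 false 012345678)))));
Entry 01021203132304140516 2434152535062636074708 (On 1 7 (On 5 7 (On 1 8 (On 5 8 (On 4 6 (Earlier 0 false
  102346785) (On 2 7 (Earlier 6 false 102347865) (On 3 7 (On 3 8 (K33 true 078135) (K33 false 0243670835)) (K5
  false 234670590)))) (K33 false 0234560718)) (K33 false 023456071811)) (K33 false 23745680)) (K33 false
  2374567180));
Entry 010212031323041405274748 24341525350626360708 (On 3 7 (K33 true 017234) (On 3 8 (K5 true 012348798) (On
  1 7 (Earlier 7 false 102347865) (On 1 8 (On 2 8 (On 5 8 (K33 true 0123482577) (K33 false 035278063471)) (K33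
  false 0235680701)) (K33 false 013278063564)))));
Entry 01021203132304140516 2434152535060708 (On 2 6 (Earlier 8 false 102346875) (On 3 6 (Earlier 8 false
  103246875) (On 4 7 (On 4 8 (On 2 7 (Earlier 0 false 012345678) (On 3 7 (Earlier 0 false 013245678) (On 1 8
  (On 5 8 (On 4 6 (Earlier 2 false 102346875) (On 5 6 (On 2 8 (K33 true 01824556) (On 3 8 (K33 true 01834556)
  (K33 false 023678))) (K33 false 23645780))) (K33 false 02356708)) (K33 false 0235670801)))) (Earlier 1 false
  012345687)) (Earlier 1 false 012345678))));
Entry 021203130414 24341525350616460717470818 (On 2 8 (On 3 8 (On 4 8 (K33 true 018234) (K33 false 014678))
  (K33 false 0143670835)) (K33 false 0142670835));
Entry 0102120313230414263647 24341525350616465607170818 (On 6 7 (K33 true 01623487) (On 2 7 (On 3 7 (K33 true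
  017234) (On 3 8 (On 4 8 (K5 true 012348798) (K33 false 0143680735)) (K33 false 013478063532))) (Earlier 31
  false 012345768)));
Entry 0102120313230414452636 2434152535061607170818 (On 4 6 (K33 true 016234) (On 5 6 (K33 true 01623485) (On
  4 7 (Earlier 0 false 012345678) (Earlier 1 false 012345678))));
Entry 021203130414 24341525350616360717270818 (On 2 8 (On 3 8 (On 4 8 (K33 true 018234) (K33 false
  045238071681)) (K33 false 013268073564)) (K33 false 012378063564));
Entry 01021203132304144526 2434152535061607170818 (On 3 6 (Earlier 1 false 012345678) (On 2 7 (On 5 6 (On 3 7
  (Earlier 1 false 012345768) (On 3 8 (On 4 8 (K5 true 01234868598) (K33 false 013467083532)) (K33 false
  013678))) (Earlier 21 false 102346578)) (Earlier 0 false 012345678)));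
Entry 01021203132304140545 2434152535 (On 0 6 (Earlier 8 false 012345678) (On 0 7 (Earlier 8 false 012345786)
  (On 0 8 (Earlier 8 false 012345876) (On 1 6 (Earlier 5 false 012345678) (On 1 7 (Earlier 5 false 012345768)
  (On 1 8 (Earlier 5 false 012345867) (On 3 6 (Earlier 0 false 013245678) (On 2 7 (Earlier 0 false 012345768)
  (Earlier 1 false 012345678)))))))));
Entry 010212031323041405062747 2434152535451626364617 (On 3 7 (K33 true 017234) (On 0 7 (Earlier 15 false
  012347865) (On 4 8 (On 3 8 (K5 true 012348798) (On 2 8 (On 1 8 (Earlier 169 true 563721408) (On 5 7 (Earlier
  132 false 241035768) (Earlier 131 false 241035768))) (K5 false 234560891))) (Earlier 14 false 012345678))));
Entry 01021203132304140506 243415253545 (On 1 6 (Earlier 69 false 012346875) (On 2 6 (Earlier 16 false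
  012346875) (On 3 6 (Earlier 16 false 013246875) (On 4 6 (Earlier 1 false 012346875) (On 1 7 (On 0 7 (Earlier
  69 false 012347865) (On 2 7 (Earlier 16 false 102347865) (On 3 7 (Earlier 16 false 103247865) (K5 false
  234560791)))) (On 4 7 (On 2 7 (Earlier 0 false 012345678) (On 3 7 (Earlier 0 false 013245678) (K5 false
  234560791))) (K33 false 12345607)))))));
Entry 0102120313230414052636 243415253545061607170818 (On 4 6 (K33 true 016234) (On 4 7 (On 5 6 (Earlier 62
  false 320165478) (Earlier 6 false 012345678)) (Earlier 7 false 012345678)));
Entry 010212031323041405 24341525354506163607170818 (On 2 7 (On 3 7 (Earlier 0 false 012345768) (On 2 8 (On 3
  8 (On 4 8 (K33 true 018234) (K33 false 013467083532)) (K33 false 013678)) (K33 false 013267083564)))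
  (Earlier 5 false 012345678));
Entry 010212031323041405 2434 (On 1 5 (Earlier 72 false 012345678) (On 2 5 (Earlier 19 false 012345678) (On 3
  5 (Earlier 19 false 013245876) (On 4 5 (Earlier 4 false 012345678) (On 0 6 (Earlier 2 false 012345678) (On 0
  7 (Earlier 2 false 012345786) (On 0 8 (Earlier 2 false 012345876) (On 1 6 (Earlier 10 false 012345678) (On 1
  7 (Earlier 10 false 012345768) (On 1 8 (Earlier 10 false 012345867) (On 2 6 (On 3 6 (Earlier 1 false
  012345678) (Earlier 0 false 012345678)) (Earlier 0 false 013245678))))))))))));
Entry 021203130414 24340515350616260717 (On 2 7 (On 3 7 (On 4 7 (K33 true 017234) (K33 false 0145676372)) (K33
  false 0135677472)) (K33 false 0125676463));
Entry 010212031323041425 24340515061607170818 (On 3 5 (Earlier 130 false 234015678) (On 2 6 (On 3 6 (Earlier 1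
  false 230165874) (On 2 7 (On 3 7 (On 4 7 (K33 true 017234) (K33 false 01356784)) (K33 false 013567)) (K33
  false 0135678482))) (Earlier 0 false 012345678)));
Entry 0102120313230414 no_pair (On 2 4 (Earlier 127 false 012345678) (On 3 4 (Earlier 127 false 013248765) (On
  0 5 (Earlier 2 false 012345678) (On 1 5 (Earlier 2 false 102345876) (On 0 6 (Earlier 2 false 012346875) (On
  1 6 (Earlier 2 false 102346875) (On 0 7 (Earlier 2 false 012347865) (On 1 7 (Earlier 2 false 102347865) (On
  0 8 (Earlier 2 false 012348765) (On 1 8 (Earlier 2 false 102348765) (On 3 5 (Earlier 0 false 013245678) (On
  2 6 (Earlier 0 false 012346578) (Earlier 1 false 012345678)))))))))))));
Entry 01021203132306 142434152535 (On 1 6 (Earlier 0 false 012368754) (On 2 6 (Earlier 0 false 021368754) (On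
  3 6 (Earlier 0 false 031268754) (K33 false 123456))));
Entry 01021203132316 142434152535060708 (On 2 6 (Earlier 1 false 120368754) (On 3 6 (Earlier 1 false
  130268754) (On 1 7 (On 1 8 (On 2 7 (Earlier 1 false 120378654) (On 3 7 (Earlier 1 false 130278654) (Earlier
  0 false 102367854))) (K33 false 1234562820)) (K33 false 1234562720))));
Entry 010212031323 142434152535 (On 0 6 (Earlier 1 false 012345678) (On 0 7 (Earlier 1 false 012345786) (On 0
  8 (Earlier 1 false 012345876) (On 1 6 (Earlier 0 false 012345678) (On 2 6 (Earlier 0 false 021345678) (On 3
  6 (Earlier 0 false 031245678) (K33 false 123456)))))));
Entry 01021203132305 142434 (On 1 5 (Earlier 3 false 012358764) (On 2 5 (Earlier 3 false 021358764) (On 3 5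
  (Earlier 3 false 031258764) (Earlier 0 false 012345678))));
Entry 010212031323 142434053506162607170818 (On 2 7 (On 2 8 (On 3 7 (Earlier 4 false 230178654) (Earlier 0
  false 201378654)) (K33 false 0124680503)) (K33 false 0124670503));
Entry 01021203132315 14243405060708 (On 2 5 (Earlier 5 false 120358764) (On 3 5 (Earlier 5 false 130258764)
  (On 1 6 (Earlier 1 false 102356874) (On 1 7 (Earlier 1 false 102357864) (On 1 8 (Earlier 1 false 102358764)
  (On 2 6 (On 3 6 (Earlier 5 false 230168754) (Earlier 0 false 013245678)) (Earlier 0 false 012345678)))))));
Entry 01021203132304 no_pair (On 1 4 (Earlier 6 false 012345678) (On 2 4 (Earlier 6 false 021348765) (On 3 4
  (Earlier 6 false 031248765) (On 0 5 (Earlier 2 false 012345678) (On 0 6 (Earlier 2 false 012346875) (On 0 7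
  (Earlier 2 false 012347865) (On 0 8 (Earlier 2 false 012348765) (On 1 5 (Earlier 0 false 012345678) (On 2 5
  (Earlier 0 false 021345678) (On 3 5 (Earlier 0 false 031245678) (Earlier 2 false 012354876)))))))))));
Entry 010212031323 no_pair (On 0 4 (Earlier 0 false 012345678) (On 1 4 (Earlier 0 false 102348765) (On 2 4
  (Earlier 0 false 201348765) (On 0 5 (Earlier 0 false 012358764) (On 1 5 (Earlier 0 false 102358764) (On 2 5
  (Earlier 0 false 201358764) (Earlier 4 false 301245876)))))));
Entry 010212031304140515 232434 (On 2 5 (Earlier 0 false 012587643) (On 3 5 (Earlier 0 false 013587642) (On 4
  5 (Earlier 0 false 014587632) (Earlier 0 true 234587610))));
Entry 02120313041448 232445265647675878 (On 2 8 (On 3 8 (K33 true 018234) (K33 false 25746823)) (K33 false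
  257468));
Entry 010212031305253527 232415453656074767082868 (On 3 7 (On 1 8 (On 5 8 (K5 true 012356877) (K33 false
  2574681380)) (K33 false 257468135180)) (K33 false 2673484580));
Entry 021203132535175708 232415453656476728 (On 7 8 (K33 true 01523728) (On 1 8 (On 5 8 (K33 true 015238) (K33
  false 25746813)) (K33 false 2574681351)));
Entry 0102120313041405253526461757 2324341545560747674868 (On 3 6 (K33 true 016234) (On 2 8 (On 3 8 (K5 true
  012356778) (On 3 7 (On 5 8 (On 0 8 (Earlier 4 false 025876431) (On 2 7 (On 1 8 (K33 true 078125) (K33 false
  357468025180)) (K33 false 2683474580))) (Earlier 179 true 468531207)) (Earlier 189 false 012543678))) (On 2
  7 (On 0 8 (Earlier 0 false 012345678) (Earlier 1 false 012345678)) (K33 false 246378))));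
Entry 01021203130414052535461757 23243415455647674868 (On 0 7 (K33 true 015237) (On 2 6 (Earlier 0 false
  012345678) (On 3 6 (Earlier 0 false 013245678) (Earlier 102 false 014623578))));
Entry 010212031304140525354657 232434154556 (On 4 7 (K33 true 01523487) (On 6 7 (K33 true 0152348786) (On 4 8
  (On 5 8 (K33 true 01523488) (On 7 8 (K33 true 0152348788) (On 2 6 (On 3 6 (K33 true 016234) (On 3 8 (K5 true
  01234758698) (K33 false 35746802))) (Earlier 4 false 012345678)))) (On 6 8 (On 5 8 (K33 true 0152348886) (On
  7 8 (K33 true 015234878886) (On 2 6 (Earlier 4 true 576840213) (On 2 8 (On 3 8 (K33 true 01823486) (K33
  false 25746823)) (K33 false 257468))))) (On 1 7 (Earlier 0 false 012345678) (On 1 8 (On 0 8 (Earlier 5 false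
  012348765) (On 5 8 (Earlier 0 false 012345687) (On 2 6 (On 3 6 (K33 true 016234) (On 0 7 (On 7 8 (K33 true
  01523758) (K5 false 45678121351)) (K5 false 4567812135190))) (On 0 7 (On 7 8 (K33 true 01523758) (K5 false
  456781251)) (K5 false 45678125190))))) (K33 false 146578)))))));
Entry 01021203130414052535264637 24344536565758 (On 4 7 (K5 true 01234758697) (On 6 7 (K33 true 01623477) (On
  7 8 (On 4 8 (K5 true 0123475869798) (On 6 8 (K33 true 0162347877) (Earlier 192 false 021345678))) (Earlier
  158 true 546718203))));
Entry 010212031304140525352646 232434154536562737573858 (On 2 8 (On 4 7 (On 7 8 (On 0 6 (On 1 6 (K33 true
  012346657877) (Earlier 1 false 021654378)) (On 0 7 (On 1 7 (K33 true 012347657688) (On 1 8 (K33 true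
  012348276576) (On 4 8 (On 6 7 (K33 true 068247) (K33 false 1263570844)) (K33 false 1342580746)))) (On 0 8
  (On 1 8 (K33 true 0123486576) (On 1 7 (K33 true 012348576576) (K33 false 126357084480))) (K33 false
  035678)))) (On 6 7 (On 4 8 (On 0 6 (On 1 6 (K33 true 0123466578) (On 1 7 (K33 true 012346576578) (K33 false
  1283570644))) (On 0 7 (On 1 7 (K33 true 016247) (On 1 6 (K33 true 012346276578) (K33 false 1283570644)))
  (K33 false 2683571450))) (K33 false 25834736)) (K33 false 26835714))) (Earlier 8 true 234786510)) (K33 false
  235478));
Entry 010212031304140525352646072728 2324341545365637573858 (On 1 7 (K33 true 0123476576) (On 4 7 (Earlier 2
  false 021754368) (On 1 8 (On 7 8 (K33 true 012347586576) (On 1 6 (On 4 8 (K33 true 068124) (K5 false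
  345780216)) (K33 false 1483570632))) (On 1 6 (On 6 7 (On 4 8 (K33 true 012346276578) (K33 false 13457836))
  (K33 false 1463570832)) (K33 false 135678)))));
Entry 010212031304140525352646 2324341545565758 (On 3 6 (K33 true 016234) (On 3 7 (Earlier 2 false 012345678)
  (On 3 8 (Earlier 2 false 012345687) (On 2 7 (On 2 8 (On 0 7 (Earlier 0 false 012345678) (On 0 8 (Earlier 0
  false 012345687) (On 0 6 (On 1 6 (Earlier 10 false 012687543) (On 1 7 (On 4 7 (Earlier 3 false 021654378)
  (On 6 7 (On 4 8 (K33 true 012346576578) (K5 false 34578021690)) (K33 false 3574680280))) (Earlier 1 false
  021563478))) (K33 false 035678)))) (Earlier 1 false 012345687)) (Earlier 1 false 012345678)))));
Entry 0102120313041405253546 2324341545263656275758 (On 3 7 (On 4 7 (Earlier 0 false 013245768) (On 3 8 (On 4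
  8 (Earlier 0 false 013245867) (On 2 8 (On 6 8 (K33 true 01823486) (On 7 8 (On 0 7 (K33 true 02315758) (On 0
  8 (K33 true 023158) (K33 false 25846780))) (K33 false 258467))) (K33 false 24537866))) (Earlier 106 false
  014623578))) (K33 false 235467));
Entry 0102120313041405253546 2324341545 (On 5 6 (K33 true 01523486) (On 5 7 (Earlier 5 false 012345678) (On 5
  8 (Earlier 5 false 012345687) (On 2 6 (Earlier 1 false 012345678) (On 3 6 (Earlier 1 false 013245678) (On 2
  7 (On 3 7 (On 0 7 (K33 true 023157) (On 4 7 (K33 true 017234) (On 6 7 (K33 true 01723486) (On 2 8 (On 0 8
  (Earlier 10 true 463750128) (On 3 8 (On 4 8 (K33 true 018234) (On 6 8 (K33 true 01823486) (K5 false
  456781290))) (K33 false 2574682380))) (Earlier 0 false 012345687))))) (Earlier 0 false 013245678)) (Earlier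
  0 false 012345678)))))));
Entry 01021203130525350626 2334154516464748 (On 3 6 (K33 true 023156) (On 5 6 (Earlier 13 false 025687431) (On
  6 7 (Earlier 0 false 021563784) (On 3 7 (On 5 7 (On 6 8 (Earlier 0 false 021563874) (Earlier 12 true
  463578210)) (Earlier 13 true 456783210)) (Earlier 13 true 346785210)))));
Entry 0102120313041405253506 2324341545464748 (On 1 6 (Earlier 13 false 012346875) (On 2 6 (Earlier 0 false
  012345678) (On 3 6 (Earlier 0 false 013245678) (Earlier 14 true 234687510))));
Entry 0102120313052535 23241545063646560717470848 (On 2 7 (On 3 7 (On 1 8 (On 5 8 (K5 true 012356877) (K33
  false 04567871)) (K33 false 01457806)) (K33 false 035467083281)) (K33 false 025467084381));
Entry 010212031305253516 232434154506364607470848 (On 5 6 (Earlier 201 true 784610532) (On 1 7 (On 1 8 (On 2 7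
  (On 3 7 (Earlier 12 false 120763458) (On 5 7 (On 2 8 (On 3 8 (K5 true 012356778) (K33 false 034678)) (K33
  false 03426708)) (K33 false 0354670832))) (On 5 7 (On 2 8 (On 3 8 (K5 true 012356778) (K33 false 03426807))
  (K33 false 02437806)) (K33 false 0254670843))) (Earlier 0 false 012345687)) (Earlier 0 false 012345678)));
Entry 0102120313041405253516 2324341545064607470848 (On 2 6 (On 3 6 (On 5 6 (On 1 7 (Earlier 2 false
  102346758) (On 1 8 (Earlier 2 false 102346857) (On 2 7 (On 3 7 (K5 true 012356677) (On 2 8 (On 3 8 (K5 true
  012356678) (K33 false 013478063562)) (K33 false 012478063573))) (On 2 8 (On 3 8 (K5 true 012356678) (K33
  false 012478063583)) (K33 false 0124780635))))) (Earlier 202 true 784620351)) (Earlier 0 false 012345678))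
  (Earlier 0 false 013245678));
Entry 01021203130414052535 23243415 (On 4 5 (K33 true 015234) (On 4 6 (Earlier 5 false 012345678) (On 4 7
  (Earlier 5 false 012345786) (On 4 8 (Earlier 5 false 012345876) (On 0 6 (Earlier 3 false 012345678) (On 0 7
  (Earlier 3 false 012345768) (On 0 8 (Earlier 3 false 012345867) (On 1 6 (Earlier 0 false 012345678) (On 1 7
  (Earlier 0 false 012345768) (On 1 8 (Earlier 0 false 012345867) (K33 false 014678)))))))))));
Entry 0102120313041405250626 232434354516 (On 3 6 (Earlier 0 false 012346875) (On 4 6 (Earlier 0 false
  012436875) (On 5 6 (Earlier 19 false 025687431) (Earlier 19 true 345687210))));
Entry 02120313041425365647 232434153545162646576748 (On 7 8 (On 5 8 (K33 true 015234768887) (On 6 8 (K33 true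
  016234658887) (On 2 8 (On 3 8 (K33 true 01823487) (K33 false 25834651)) (K33 false 24536871)))) (On 2 7 (On
  3 7 (K33 true 017234) (K33 false 2573465178)) (K33 false 2453675871)));
Entry 0102120313041425365647 232434153545162646 (On 5 7 (K33 true 0152347687) (On 6 7 (K33 true 0162346587)
  (On 4 8 (On 5 8 (K33 true 0152347688) (On 6 8 (K33 true 0162346588) (On 2 7 (On 3 7 (K33 true 017234) (On 3
  8 (K5 true 0123475768798) (K33 false 27835614))) (Earlier 19 false 012345768)))) (Earlier 0 false
  012345678))));
Entry 01021203130525063656 232434153545162646174748 (On 2 7 (On 3 7 (On 0 7 (K33 true 02315776) (On 1 8 (On 5
  8 (K5 true 01235687796) (On 6 8 (K33 true 0261354768) (K33 false 1284560743))) (Earlier 70 false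
  013426578))) (K33 false 13425706)) (K33 false 12436705));
Entry 01030536561718 232434153516264607274708 (On 5 7 (On 5 8 (On 3 7 (Earlier 49 false 052463178) (Earlier 23
  true 234786510)) (K33 false 245367718880)) (K33 false 24536771));
Entry 0102120313041405253607 23243415354516264656 (On 1 7 (Earlier 23 false 012347865) (On 2 7 (Earlier 4
  false 012345786) (On 4 7 (On 3 7 (Earlier 5 false 013427865) (On 5 7 (Earlier 2 false 012435768) (On 6 7
  (Earlier 2 false 013426758) (Earlier 24 true 156784320)))) (K33 false 12436705))));
Entry 010212031304140525061727 23243415354516260708 (On 3 7 (Earlier 6 false 102347865) (On 4 7 (Earlier 6
  false 102437865) (On 6 7 (On 6 8 (Earlier 1 false 063541278) (K33 false 257346518088)) (K33 false
  25734651))));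
Entry 01021203130414052536174757 23241535451626073708 (On 6 7 (K33 true 0172346576) (On 4 8 (On 2 8 (K33 true
  02714548) (Earlier 151 false 401356782)) (K33 false 257346517078)));
Entry 010212031304140525063617 232434153545162646560708 (On 2 7 (Earlier 1 false 012345678) (On 3 7 (Earlier 1
  false 013246578) (On 4 7 (On 5 7 (Earlier 0 false 012345678) (On 6 7 (Earlier 0 false 013246578) (Earlier 8
  true 564713820))) (Earlier 27 true 234786510))));
Entry 010212031304140636 2324341535451626460717470818 (On 2 7 (On 3 7 (On 2 8 (On 3 8 (On 4 8 (K33 true
  018234) (Earlier 187 false 301247685)) (K33 false 134257065850)) (K33 false 124367055850)) (K33 false
  13425706)) (K33 false 12436705));
Entry 0102120313041405250636 2324341535451626 (On 4 6 (Earlier 10 false 013426875) (On 5 6 (On 4 7 (Earlier 7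
  false 012345678) (On 4 8 (Earlier 7 false 012345687) (On 1 7 (On 0 7 (Earlier 28 false 012347865) (On 1 8
  (On 0 8 (Earlier 28 false 012348765) (On 2 7 (On 3 7 (Earlier 10 false 102347865) (Earlier 5 false
  013246578)) (Earlier 5 false 012345678))) (Earlier 6 false 012345687))) (Earlier 6 false 012345678)))) (On 0
  7 (Earlier 4 false 012345678) (On 0 8 (Earlier 4 false 012345687) (On 1 7 (Earlier 1 false 012345678) (On 1
  8 (Earlier 1 false 012345687) (On 4 7 (On 4 8 (On 2 7 (Earlier 72 false 012435678) (On 3 7 (Earlier 72 false
  013426578) (Earlier 84 false 012345678))) (Earlier 0 false 013246587)) (Earlier 0 false 012345678))))))));
Entry 01021203130414052506 232434153545 (On 1 6 (Earlier 29 false 012346875) (On 2 6 (Earlier 10 false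
  012345678) (On 3 6 (Earlier 0 false 012345678) (On 4 6 (Earlier 0 false 012435687) (Earlier 30 true
  234687510)))));
Entry 0102120313041405251636 23243415354506260708 (On 4 6 (Earlier 12 false 103426875) (On 1 7 (Earlier 0
  false 103246785) (On 1 8 (Earlier 0 false 103246875) (On 2 7 (On 5 6 (On 3 7 (K33 true 02613547) (On 2 8 (On
  3 8 (K33 true 02613548) (K33 false 013278063534)) (K33 false 025348071681))) (Earlier 70 false 012435678))
  (On 2 8 (On 3 8 (On 4 8 (K33 true 018234) (On 5 6 (K33 true 02613548) (K33 false 025367080481))) (K33 false
  025347081681)) (K33 false 012378060435))))));
Entry 01021203130414052516 232434153545060708 (On 2 6 (On 3 6 (Earlier 13 false 102346875) (On 4 6 (Earlier 13
  false 102436875) (On 5 6 (On 1 7 (Earlier 1 false 102346785) (On 2 7 (On 2 8 (On 1 8 (Earlier 1 false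
  102346875) (On 3 7 (On 4 7 (K33 true 017234) (On 4 8 (K33 true 012345566778) (K33 false 014378063562))) (On
  4 7 (On 3 8 (K33 true 012345566877) (K33 false 013478063562)) (K33 false 0345670801)))) (K33 false
  034256081711)) (K33 false 2563475180))) (Earlier 32 true 345687210)))) (On 3 6 (Earlier 0 false 012345678)
  (On 4 6 (Earlier 0 false 012435678) (Earlier 32 true 234687510))));
Entry 0212031304142636 2324341535061607170818 (On 4 6 (K33 true 016234) (On 2 7 (On 3 7 (On 4 7 (K33 true
  017234) (On 2 8 (On 3 8 (On 4 8 (K33 true 018234) (K33 false 014678)) (K33 false 014367083562)) (K33 false
  014267083533))) (Earlier 43 false 013426785)) (Earlier 43 false 012436785)));
Entry 02120313041426 232434153545061607170818 (On 3 6 (Earlier 0 false 012345678) (On 4 6 (Earlier 0 false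
  012435678) (On 2 7 (On 3 7 (Earlier 0 false 012345768) (Earlier 44 false 013426785)) (K33 false
  2563475180))));
Entry 010212031304140525 23243415 (On 3 5 (Earlier 16 false 012345678) (On 4 5 (Earlier 16 false 012435876)
  (On 0 6 (Earlier 4 false 012345678) (On 0 7 (Earlier 4 false 012345786) (On 0 8 (Earlier 4 false 012345876)
  (On 1 6 (Earlier 2 false 012345678) (On 1 7 (Earlier 2 false 012345768) (On 1 8 (Earlier 2 false 012345867)
  (On 2 6 (Earlier 0 false 012345678) (On 2 7 (Earlier 0 false 012345768) (Earlier 56 false
  013425678)))))))))));
Entry 0102120313041405 232434 (On 1 5 (Earlier 35 false 012345678) (On 2 5 (Earlier 0 false 012345678) (On 3 5
  (Earlier 0 false 013245876) (On 4 5 (Earlier 0 false 014235876) (Earlier 36 true 234587610)))));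
Entry 02120313041425 2324340515061607170818 (On 3 5 (Earlier 177 false 234015678) (On 4 5 (Earlier 177 false
  243015678) (On 2 6 (Earlier 2 false 102345678) (Earlier 47 false 012435678))));
Entry 01021203130414 23 (On 2 4 (Earlier 38 false 012487653) (On 3 4 (Earlier 38 false 013487652) (On 0 5
  (Earlier 1 false 012345678) (On 1 5 (Earlier 1 false 102345876) (On 0 6 (Earlier 1 false 012346875) (On 1 6
  (Earlier 1 false 102346875) (On 0 7 (Earlier 1 false 012347865) (On 1 7 (Earlier 1 false 102347865) (On 0 8
  (Earlier 1 false 012348765) (On 1 8 (Earlier 1 false 102348765) (On 2 5 (Earlier 0 false 012345678) (On 3 5
  (Earlier 0 false 013245678) (On 4 5 (Earlier 0 false 014235678) (Earlier 38 true 234587610))))))))))))));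
Entry 010212031304243407 23141525354516263646 (On 1 7 (Earlier 0 false 012378654) (On 2 7 (Earlier 0 false
  021478653) (On 3 7 (On 4 7 (Earlier 39 false 034786521) (K33 false 124567)) (K33 false 123567))));
Entry 0103041747 23141525351626360757670828 (On 3 7 (On 1 8 (On 3 8 (On 4 8 (K33 true 078134) (K33 false
  1275682480)) (K33 false 23756880)) (K33 false 12756880)) (K5 false 23567383071));
Entry 010212031304243405061747 23141525351626360708 (On 5 7 (K33 true 01423725) (On 6 7 (K33 true 01423726)
  (On 2 8 (On 3 8 (K5 true 012346778) (Earlier 0 false 013245678)) (Earlier 0 false 012345678))));
Entry 0103131718 1415253516263607274708 (On 3 7 (On 3 8 (Earlier 3 false 130786542) (K33 false 123567248880))
  (K33 false 12356724));
Entry 0102120313042434050617 231415253545162636460708 (On 4 7 (Earlier 1 false 012345678) (On 1 8 (On 2 7 (On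
  3 7 (Earlier 1 false 021435678) (Earlier 0 false 013245678)) (Earlier 0 false 012345678)) (On 2 7 (On 3 7
  (On 5 7 (K33 true 02314725) (On 6 7 (K33 true 02314726) (K5 false 14567383072))) (K33 false 124567282053))
  (K33 false 1245672820))));
Entry 01021203130424340506 231415253545 (On 1 6 (Earlier 5 false 012368754) (On 2 6 (Earlier 5 false
  021468753) (On 3 6 (Earlier 5 false 031468752) (On 4 6 (Earlier 5 false 042368751) (On 0 7 (Earlier 4 false
  012345678) (On 0 8 (Earlier 4 false 012345687) (On 1 7 (Earlier 0 false 012345678) (On 2 7 (Earlier 0 false
  021435678) (On 3 7 (On 4 7 (On 3 8 (On 4 8 (Earlier 5 false 340786521) (K33 false 1245678880)) (K33 false
  1235678880)) (K33 false 124567)) (K33 false 123567))))))))));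
Entry 010212031304243405 2314152506560717370838 (On 1 8 (On 4 8 (On 5 8 (K33 true 01423825) (On 2 6 (On 3 6
  (K5 true 012346876) (K33 false 03567871)) (K33 false 0352780671))) (K33 false 013578065462)) (K33 false
  0135780662));
Entry 0102120313042434051627 2314152545065607370838 (On 1 7 (On 2 6 (Earlier 7 false 120678543) (On 4 7 (On 5
  7 (K33 true 01423725) (On 1 8 (On 4 8 (On 5 8 (K33 true 01423825) (K33 false 03527806)) (K33 false
  035278068184)) (K33 false 0352780681))) (Earlier 0 false 042315678))) (Earlier 0 false 012345678));
Entry 010212031304243405164627 23141525354506560708 (On 3 7 (K5 true 012346677) (On 3 8 (On 2 8 (K5 true
  012346678) (On 5 7 (On 5 8 (K33 true 0231455788) (On 2 6 (On 1 7 (Earlier 8 false 120678543) (Earlier 44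
  false 240671538)) (K33 false 02536807))) (On 3 6 (On 1 8 (Earlier 8 false 130687542) (Earlier 44 false
  340681527)) (K33 false 03526708)))) (Earlier 0 false 012345678)));
Entry 0102120313042434051646 231415253545060708 (On 5 6 (K33 true 01423625) (On 2 7 (Earlier 0 false
  012345678) (On 3 7 (Earlier 0 false 013245678) (On 2 8 (Earlier 0 false 012345687) (On 3 8 (Earlier 1 false
  013245687) (K33 false 02357806))))));
Entry 010212031304243405265637 2314152535450636460708 (On 5 7 (K33 true 0231455687) (On 2 7 (Earlier 0 false
  021435768) (On 3 8 (On 5 8 (K33 true 0231455688) (On 1 7 (On 4 7 (On 2 8 (K5 true 012346778) (K33 false
  02537806)) (K33 false 024567084361)) (K33 false 012567084473))) (Earlier 3 false 042315768))));
Entry 010212031304243405162617 231415253545063646560708 (On 2 7 (Earlier 11 false 120678543) (On 4 7 (Earlier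
  1 false 012345768) (On 1 8 (On 5 8 (On 4 8 (K33 true 01423825) (Earlier 4 false 021435678)) (K33 false
  024567084361)) (K33 false 024167083543))));
Entry 0102120313042434051626 23141525354506460708 (On 3 6 (Earlier 2 false 021435678) (On 5 6 (On 3 7 (Earlier
  1 false 012345678) (On 4 7 (Earlier 1 false 021435678) (On 1 8 (On 2 8 (On 5 8 (K33 true 068125) (K33 false
  034567083261)) (K33 false 034267086165)) (K33 false 034167083235)))) (On 1 7 (Earlier 0 false 012345678) (On
  2 7 (Earlier 0 false 021435678) (On 1 8 (Earlier 0 false 012345687) (Earlier 5 false 024135678))))));
Entry 01021203130424340516 231415253545060708 (On 4 6 (Earlier 3 false 012345678) (On 2 6 (Earlier 0 false
  012345678) (On 3 6 (Earlier 0 false 013245678) (On 5 6 (On 4 7 (Earlier 2 false 031425678) (On 4 8 (Earlier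
  2 false 031425687) (On 2 7 (On 1 7 (Earlier 0 false 012345768) (On 2 8 (On 3 8 (On 5 8 (K33 true 02314825)
  (K33 false 0451680772)) (K33 false 024168073553)) (K33 false 0241680735))) (Earlier 147 false 316720458))))
  (Earlier 52 true 235687410)))));
Entry 010212031304243405 2314 (On 1 5 (Earlier 14 false 012358764) (On 2 5 (Earlier 14 false 021458763) (On 3
  5 (Earlier 14 false 031458762) (On 4 5 (Earlier 14 false 042358761) (On 0 6 (Earlier 8 false 012345678) (On
  0 7 (Earlier 8 false 012345786) (On 0 8 (Earlier 8 false 012345876) (On 1 6 (Earlier 0 false 012345678) (On
  2 6 (Earlier 0 false 021435678) (On 3 6 (Earlier 0 false 031425678) (On 4 6 (Earlier 0 false 042315678) (On
  1 7 (Earlier 0 false 012345768) (On 2 7 (Earlier 0 false 021435768) (On 3 7 (On 4 7 (On 3 8 (On 4 8 (Earlier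
  14 false 340786521) (K33 false 0124670865)) (K33 false 0123670835)) (K33 false 124567)) (K33 false
  123567)))))))))))))));
Entry 01021203130424341546562778 140545061647670818 (On 3 7 (K5 true 01234656677) (On 3 8 (K5 true
  0123465667778) (K33 false 0174680583)));
Entry 01021203130424341525352636 23140545061607170818 (On 4 7 (On 4 6 (Earlier 1 false 402367851) (Earlier 88
  false 124053678)) (On 4 6 (On 5 6 (On 5 7 (Earlier 1 false 512367840) (On 6 7 (Earlier 1 false 624537810)
  (On 7 8 (On 5 8 (Earlier 1 false 512368740) (On 6 8 (Earlier 1 false 624538710) (On 2 7 (Earlier 0 false
  012345678) (Earlier 0 true 057864123)))) (K33 false 01746805)))) (Earlier 162 false 234615078)) (Earlier 89
  false 124053678)));
Entry 0102120313042434152535 2314054506163607170818 (On 2 7 (On 3 7 (Earlier 0 false 012345768) (On 2 8 (On 3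
  8 (Earlier 0 false 012345867) (K33 false 013678)) (K33 false 01367882))) (On 2 8 (On 3 8 (Earlier 0 false
  012345867) (K33 false 01367872)) (K33 false 01267863)));
Entry 0102120313042434152535 231405060708 (On 1 6 (Earlier 3 false 102356874) (On 1 7 (Earlier 3 false
  102357864) (On 1 8 (Earlier 3 false 102358764) (On 4 5 (On 2 6 (Earlier 3 false 201456873) (Earlier 231 true
  678015423)) (On 2 6 (On 3 6 (Earlier 1 false 012345678) (Earlier 0 false 012345678)) (Earlier 0 false
  013245678))))));
Entry 010212031304243415251636 231405354506260708 (On 4 6 (Earlier 0 false 031426578) (On 1 7 (On 2 7 (Earlier
  19 false 120578643) (On 4 7 (On 5 6 (K5 true 01234677576) (On 3 7 (Earlier 19 false 130678542) (On 5 7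
  (Earlier 163 false 142073568) (On 3 8 (On 5 8 (K5 true 01234677578) (Earlier 243 true 685710423)) (K33 false
  0253670874))))) (K33 false 02456733))) (On 2 7 (On 3 7 (On 4 7 (Earlier 0 false 042317568) (On 4 8 (On 1 8
  (K5 true 012346877) (On 5 8 (K5 true 01234656877) (On 6 8 (K5 true 01234666877) (K33 false 04815607)))) (On
  2 8 (On 3 8 (On 1 8 (Earlier 19 false 120587643) (On 5 7 (On 5 8 (K33 true 07823521) (On 6 8 (K33 true
  0561235778) (K5 false 0456807017372))) (Earlier 219 false 310248675))) (K33 false 03456842)) (K33 false
  02456833)))) (K33 false 0345674281)) (K33 false 0245673381))));
Entry 010212031304243425164637 2305350626360708 (On 2 7 (K5 true 012346677) (On 5 7 (K5 true 01234667577) (On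
  5 6 (Earlier 164 false 142063578) (On 3 8 (On 5 8 (K5 true 01234667578) (Earlier 244 true 785610423)) (K33
  false 02536708)))));
Entry 010212031304243415251646 23140535450626360717370838 (On 1 8 (On 4 8 (On 2 8 (Earlier 21 false 120587643)
  (On 2 7 (On 4 7 (Earlier 1 false 021435768) (On 5 6 (Earlier 220 false 140235678) (Earlier 207 false
  410235678))) (K33 false 023678))) (K33 false 03457871)) (K33 false 01357834));
Entry 010212031304243415251646 23140535450626360708 (On 3 7 (Earlier 1 false 012345678) (On 3 8 (Earlier 1
  false 012345687) (On 1 7 (On 2 7 (Earlier 22 false 120578643) (On 2 8 (On 1 8 (Earlier 22 false 120587643)
  (Earlier 0 false 012345687)) (K33 false 023678))) (Earlier 0 false 012345678))));
Entry 0102120313042434152516 2314053545060708 (On 2 6 (Earlier 23 false 120568743) (On 3 6 (Earlier 3 false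
  012345678) (On 4 6 (Earlier 0 false 012345678) (On 1 7 (On 2 7 (Earlier 23 false 120578643) (On 4 7 (On 3 7
  (Earlier 4 false 031427568) (Earlier 0 false 012345768)) (K33 false 02456733))) (On 2 7 (On 3 7 (On 4 7
  (Earlier 4 false 042317568) (Earlier 0 false 021435768)) (K33 false 0345674281)) (K33 false 0245673381))))));
Entry 01021203130424341525 231405060708 (On 3 5 (Earlier 5 false 012345678) (On 4 5 (Earlier 5 false
  021435678) (On 1 6 (Earlier 0 false 012345678) (On 2 6 (Earlier 0 false 021435678) (On 1 7 (Earlier 0 false
  012345768) (On 2 7 (Earlier 0 false 021435768) (K33 false 0125673463)))))));
Entry 0102120424154526 140525350616360717370838 (On 1 8 (On 4 8 (On 2 8 (Earlier 10 false 201486753) (On 2 7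
  (On 5 6 (Earlier 212 false 140236578) (Earlier 211 false 140236578)) (K33 false 023578))) (K33 false
  01367854)) (K33 false 013678));
Entry 0102120313042434154526 2314052535060708 (On 3 6 (K5 true 012346576) (On 1 6 (Earlier 1 false 012346578)
  (On 3 7 (Earlier 5 false 012346578) (On 3 8 (Earlier 5 false 012346587) (On 1 7 (On 2 7 (Earlier 1 false
  012347568) (On 2 8 (On 1 8 (Earlier 1 false 012348567) (Earlier 0 false 012345687)) (K33 false 023578)))
  (Earlier 0 false 012345678))))));
Entry 01021203130424341545 2314052535060708 (On 2 6 (Earlier 0 false 012345678) (On 3 6 (Earlier 0 false
  013245678) (On 2 7 (Earlier 0 false 012345768) (On 3 7 (Earlier 0 false 013245768) (K33 false 023567)))));
Entry 0103130434 23140525354506263646072708 (On 1 7 (On 3 7 (On 4 7 (On 3 8 (Earlier 13 false 301478652) (K5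
  false 02356071894)) (K33 false 024567)) (K33 false 023567)) (K33 false 02456781));
Entry 010212031304243416 231405253545060708 (On 2 6 (Earlier 4 false 012346578) (On 3 6 (Earlier 4 false
  013246578) (On 4 6 (Earlier 1 false 012346578) (On 2 7 (On 1 7 (Earlier 4 false 012347568) (On 3 7 (On 4 7
  (Earlier 4 false 024137568) (Earlier 1 false 021437568)) (K33 false 0245675381))) (Earlier 0 false
  012345678)))));
Entry 010212031304243415 231405253545061626071708 (On 2 7 (On 3 7 (On 4 6 (On 5 6 (K5 true 01234656677) (On 3
  6 (Earlier 5 false 034126578) (Earlier 69 true 235687410))) (Earlier 0 false 031426758)) (K33 false
  0125673483)) (K33 false 01256734));
Entry 010212031304243415 231405060708 (On 2 5 (Earlier 6 false 012345678) (On 3 5 (Earlier 6 false 013245678)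
  (On 4 5 (Earlier 3 false 012345678) (On 1 6 (Earlier 1 false 012345678) (On 1 7 (Earlier 1 false 012345768)
  (On 2 6 (On 3 6 (On 4 6 (Earlier 6 false 024136578) (Earlier 3 false 021436578)) (Earlier 0 false
  013245678)) (Earlier 0 false 012345678)))))));
Entry 0102120313042434 2314 (On 0 5 (Earlier 17 false 012345678) (On 0 6 (Earlier 17 false 012346875) (On 0 7
  (Earlier 17 false 012347865) (On 0 8 (Earlier 17 false 012348765) (On 1 5 (Earlier 0 false 012345678) (On 2
  5 (Earlier 0 false 021435678) (On 4 5 (Earlier 0 false 042315678) (On 1 6 (Earlier 0 false 012346578) (On 2
  6 (Earlier 0 false 021436578) (On 4 6 (Earlier 0 false 042316578) (On 1 7 (Earlier 0 false 012347568)
  (Earlier 3 false 031425678))))))))))));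
Entry 0102120313042405354507 231434152526364656 (On 1 7 (Earlier 33 false 012378654) (On 2 7 (Earlier 33 false
  021478653) (On 6 7 (On 3 7 (Earlier 33 false 031578642) (On 4 7 (Earlier 33 false 042578631) (Earlier 0 true
  326748510))) (K33 false 12635704))));
Entry 01021203130424354506176768 2314341516264656 (On 4 7 (K33 true 0142372675) (On 5 7 (K33 true 0152372664)
  (On 4 8 (K33 true 014236577588) (On 5 8 (K33 true 015236576488) (On 2 7 (On 3 7 (K33 true 0231472675) (On 3
  8 (K33 true 023146577588) (K33 false 1783450602))) (Earlier 69 true 546702138))))));
Entry 0102120313042405354506 2314341525 (On 1 6 (Earlier 35 false 012368754) (On 2 6 (Earlier 35 false
  021468753) (On 3 6 (Earlier 35 false 031568742) (On 4 6 (Earlier 35 false 042568731) (On 5 6 (Earlier 35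
  false 053468721) (On 6 7 (On 6 8 (On 2 7 (Earlier 0 false 021435678) (On 3 7 (Earlier 0 false 031524678) (On
  4 7 (Earlier 0 false 042513678) (Earlier 2 true 326748510)))) (Earlier 1 true 651243087)) (Earlier 1 true
  651243078)))))));
Entry 0102120313042405354516265637 231434152506360708 (On 2 7 (K33 true 0251344766) (On 4 7 (K33 true
  0142355677) (On 1 8 (Earlier 71 false 150672348) (K33 false 024137081635))));
Entry 0102030424053545 231434152506364656071708 (On 2 7 (On 3 7 (On 2 8 (On 3 8 (On 4 7 (Earlier 72 false
  230764158) (On 5 7 (Earlier 72 false 320765148) (Earlier 55 true 674503281))) (K33 false 045136071872)) (K33
  false 035126071834)) (K33 false 1364574280)) (K33 false 1263570480));
Entry 010212031304240535451626 2314341525060708 (On 3 6 (Earlier 5 false 102368754) (On 4 6 (Earlier 5 false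
  201468753) (On 5 6 (On 3 7 (Earlier 1 false 012345678) (On 4 7 (Earlier 1 false 021435678) (On 1 8 (On 2 8
  (On 3 8 (K33 true 0251344866) (On 4 8 (K33 true 0152345866) (K33 false 034678))) (K33 false 034267086165))
  (K33 false 034167083235)))) (On 1 7 (On 2 7 (Earlier 38 false 120678543) (Earlier 0 false 021435678))
  (Earlier 0 false 012345678)))));
Entry 010304053545 231434152506263656072708 (On 1 7 (On 4 7 (On 1 8 (On 4 8 (On 3 7 (Earlier 74 false
  140763258) (On 5 7 (On 5 8 (K33 true 078145) (K33 false 023567086461)) (K5 false 23567444190))) (K33 false
  035246071871)) (K33 false 035126081734)) (K33 false 2463574180)) (K33 false 1263570480));
Entry 010212031304240535451646 23143415250626360708 (On 5 6 (Earlier 1 false 045231678) (On 2 7 (On 3 7 (K5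
  true 01234667795) (On 5 7 (K33 true 0152345667) (On 2 8 (On 3 8 (K5 true 01234667895) (On 5 8 (K33 true
  0152345668) (K33 false 03527806))) (K33 false 03526708)))) (Earlier 0 false 012345678)));
Entry 0102120313042405354516 2314341525060708 (On 2 6 (Earlier 2 false 012345678) (On 3 6 (Earlier 2 false
  013254678) (On 4 6 (Earlier 0 false 012345678) (On 5 6 (Earlier 0 false 013254678) (On 1 7 (On 2 7 (Earlier
  2 false 012345768) (Earlier 1 false 042513678)) (Earlier 3 false 012345678))))));
Entry 01021203130424053545 2314341525 (On 0 6 (Earlier 6 false 012345678) (On 0 7 (Earlier 6 false 012345786)
  (On 0 8 (Earlier 6 false 012345876) (On 1 6 (Earlier 0 false 012345678) (On 2 6 (Earlier 0 false 021435678)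
  (On 3 6 (Earlier 0 false 031524678) (On 4 6 (Earlier 0 false 042513678) (On 5 6 (Earlier 0 false 053412678)
  (Earlier 6 true 614532087)))))))));
Entry 010212031304240535465607 231434152545162636 (On 1 7 (Earlier 43 false 012378654) (On 2 7 (Earlier 43
  false 021478653) (On 3 7 (On 4 7 (K33 true 0341576276) (K33 false 12435706)) (K33 false 12346735))));
Entry 010212031304350646561727 23143415254516263607375708 (On 6 7 (On 1 8 (On 4 8 (K33 true 016234586775)
  (Earlier 208 false 102365784)) (K33 false 135247062820)) (K33 false 12735604));
Entry 0102120313042405350646561727 2314341525451626360708 (On 3 7 (Earlier 12 false 102378654) (On 4 7
  (Earlier 12 false 201478653) (On 5 7 (On 6 7 (On 1 8 (Earlier 154 false 015326478) (Earlier 155 false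
  015326478)) (Earlier 0 false 021436578)) (Earlier 0 false 012345678))));
Entry 01021203130424053506465617 2314341525451626360708 (On 2 7 (Earlier 0 false 012345678) (On 3 7 (Earlier 0
  false 013254678) (On 1 8 (On 6 7 (On 4 7 (Earlier 0 false 046251378) (On 6 8 (On 5 7 (Earlier 141 false
  076514328) (Earlier 13 true 723548610)) (K33 false 137246058088))) (Earlier 85 true 236785410)) (K33 false
  123467282035))));
Entry 0102120313042405350646 2314341525451626365617 (On 2 7 (On 0 7 (Earlier 47 false 021478653) (On 5 7 (On 2
  8 (On 0 8 (Earlier 47 false 021487653) (On 3 8 (On 4 8 (K33 true 0231455778) (On 6 8 (K33 true 023145577876)
  (Earlier 45 false 031524687))) (On 5 8 (On 3 7 (Earlier 146 true 536241078) (On 6 7 (Earlier 112 false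
  021346578) (Earlier 4 true 615723840))) (K33 false 135248062720)))) (On 0 8 (On 1 8 (On 7 8 (K33 true
  01723875) (K33 false 1352460708)) (K33 false 13524608)) (K33 false 135246070008))) (Earlier 47 true
  154678320))) (K33 false 13524607));
Entry 0102120313042405350646 231434152545162636 (On 5 6 (On 0 7 (Earlier 4 false 012345678) (On 0 8 (Earlier 4
  false 012345687) (On 1 7 (Earlier 1 false 012345678) (On 2 7 (Earlier 1 false 021436578) (On 3 7 (Earlier 1
  false 031526478) (K33 false 12346735)))))) (On 1 7 (On 0 7 (Earlier 48 false 012378654) (On 2 7 (On 1 8 (On
  2 8 (Earlier 48 false 120786543) (Earlier 0 false 021436587)) (Earlier 0 false 012345687)) (Earlier 0 false
  021436578))) (Earlier 0 false 012345678)));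
Entry 01021203130424053506 231434152545 (On 1 6 (Earlier 49 false 012368754) (On 2 6 (Earlier 49 false
  021468753) (On 3 6 (Earlier 49 false 031568742) (On 4 6 (Earlier 0 false 012345678) (On 5 6 (Earlier 0 false
  013254687) (Earlier 88 true 145687320))))));
Entry 010212130424053516265637 231434152506360708 (On 2 7 (K33 true 03612547) (On 4 7 (K33 true 0231455677)
  (On 1 8 (On 5 8 (On 2 8 (K33 true 068125) (On 4 8 (K33 true 02814556) (K33 false 02437806))) (K33 false
  024357061871)) (K33 false 024137081635))));
Entry 010205162656 231434152506460717370838 (On 1 8 (On 2 8 (On 5 8 (K33 true 068125) (K33 false
  013457061872)) (K33 false 013247081635)) (K33 false 01347806));
Entry 0102120516265617 2314341525064607370838 (On 2 7 (Earlier 52 false 120678543) (On 1 8 (On 2 8 (On 5 8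
  (K33 true 068125) (K33 false 035248071671)) (K33 false 023478063531)) (K33 false 013248071635)));
Entry 0102121304240535162656 23143415250636460708 (On 3 7 (Earlier 2 false 012345678) (On 3 8 (Earlier 2 false
  012345687) (On 1 7 (Earlier 0 false 012345678) (Earlier 1 false 012345678))));
Entry 0102120313042405351626 231434152545060708 (On 3 6 (Earlier 21 false 102368754) (On 4 6 (Earlier 21 false
  201468753) (On 5 6 (Earlier 0 false 012345678) (On 1 7 (On 2 7 (Earlier 54 false 120678543) (On 4 7 (On 1 8
  (On 4 8 (On 3 7 (Earlier 210 false 142078653) (On 5 7 (Earlier 89 false 410765238) (On 2 8 (On 3 8 (K33 true
  01823457) (On 5 8 (K33 true 0182345775) (K33 false 035248071671))) (K33 false 035247081671)))) (K33 false
  035246071871)) (K33 false 035126081734)) (K33 false 2463574180))) (On 2 7 (On 3 7 (On 2 8 (On 3 8 (On 1 8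
  (Earlier 54 false 120687543) (On 4 7 (On 4 8 (K33 true 078234) (On 5 8 (K33 true 0231455877) (K33 false
  045138071672))) (On 5 7 (On 4 8 (K33 true 0231455778) (K33 false 014378063532)) (K33 false 045137081672))))
  (K33 false 045136071872)) (K33 false 035126071834)) (K33 false 1364574280)) (K33 false 1263570480))))));
Entry 011203130424053516465627 231434152506260708 (On 3 7 (K33 true 0261344775) (On 5 7 (K33 true 02614557)
  (On 4 8 (Earlier 90 false 410675238) (K33 false 035247061871))));
Entry 0212031304164628 231434152506260717370818 (On 3 8 (On 4 8 (K33 true 01823456) (K33 false 013247061835))
  (K33 false 0132780635));
Entry 02120313041646273728 2314341525062607170818 (On 4 7 (K33 true 01723456) (On 3 8 (On 4 8 (K33 true
  01823456) (K33 false 014278063563)) (K33 false 013248061735)));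
Entry 0102120313042405351646 2314341525450626360708 (On 5 6 (On 2 7 (Earlier 2 false 012345678) (On 3 7
  (Earlier 2 false 013254678) (On 1 8 (On 4 8 (On 5 8 (K33 true 068145) (K33 false 023567086461)) (K33 false
  023467083531)) (K33 false 023167083564)))) (On 2 7 (On 1 7 (Earlier 3 false 012345768) (On 2 8 (On 1 8
  (Earlier 3 false 012345867) (On 3 7 (Earlier 0 false 012345678) (Earlier 1 false 012345678))) (K33 false
  035126071834))) (Earlier 18 false 042513678)));
Entry 01021203130424053516 231434152545060708 (On 2 6 (Earlier 4 false 012345678) (On 3 6 (Earlier 4 false
  013254678) (On 4 6 (Earlier 0 false 012345678) (On 5 6 (Earlier 0 false 013254678) (Earlier 26 true
  623548710)))));
Entry 010212130424053526364627 1415450617 (On 5 7 (K33 true 0231455776) (On 4 7 (Earlier 60 false 240678531)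
  (Earlier 99 true 145786320)));
Entry 010212031304240535263646 2314341525450607170818 (On 2 7 (Earlier 0 false 012345678) (On 5 6 (On 3 7
  (Earlier 0 false 013254678) (On 2 8 (Earlier 0 false 012345687) (Earlier 207 false 063524178))) (Earlier 9
  false 024153678)));
Entry 0102120313042405352636 231434152545061607170818 (On 4 6 (Earlier 0 false 012345678) (On 5 6 (Earlier 0
  false 013254678) (Earlier 101 true 145687320)));
Entry 01021203130424053526 231434152545061607170818 (On 3 6 (Earlier 0 false 012345678) (On 2 7 (On 3 7
  (Earlier 0 false 012345768) (On 2 8 (On 3 8 (On 4 8 (Earlier 2 false 012345867) (K33 false 01346708)) (K33
  false 013678)) (K33 false 0132670835))) (On 5 6 (On 3 8 (On 4 8 (K33 true 0231455678) (K33 false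
  013246071835)) (K33 false 0132680735)) (K33 false 1263570480))));
Entry 010212031304240535 2314341525 (On 4 5 (Earlier 21 false 012345678) (On 0 6 (Earlier 14 false 012345678)
  (On 0 7 (Earlier 14 false 012345786) (On 0 8 (Earlier 14 false 012345876) (On 1 6 (Earlier 4 false
  012345678) (On 1 7 (Earlier 4 false 012345768) (On 1 8 (Earlier 4 false 012345867) (On 2 6 (Earlier 0 false
  012345678) (On 3 6 (Earlier 0 false 013254678) (On 2 7 (Earlier 0 false 012345768) (On 3 7 (On 4 7 (On 2 8
  (On 5 8 (K33 true 0231455877) (K33 false 01256708)) (K33 false 012678)) (K33 false 1372460580)) (K33 false
  12346735))))))))))));
Entry 0102120313042406 23143415253545 (On 1 6 (Earlier 65 false 012368754) (On 2 6 (Earlier 65 false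
  021468753) (On 3 6 (Earlier 0 false 012346875) (On 4 6 (Earlier 0 false 021436875) (On 5 6 (Earlier 32 true
  325648710) (Earlier 104 true 145687320))))));
Entry 01021203130424051656375758 2314341525354506460708 (On 2 7 (K33 true 01723556) (On 4 7 (K33 true
  0172355664) (On 3 8 (On 2 8 (K33 true 01823556) (On 4 8 (K33 true 0182355664) (On 3 6 (On 1 7 (K33 true
  067135) (On 1 8 (K33 true 068135) (K33 false 0124780663))) (K33 false 02437806)))) (On 2 6 (On 1 8 (On 2 8
  (K33 true 068125) (On 4 8 (K33 true 02814556) (Earlier 33 true 325847610))) (K33 false 013248071635)) (K33
  false 02436708)))));
Entry 010205165658 231434152506460717370838 (On 2 6 (On 1 8 (On 2 8 (K33 true 068125) (K33 false
  013247081635)) (K33 false 01347806)) (K33 false 1362470580));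
Entry 010212031304240516565758 23143415253545060708 (On 4 6 (On 2 7 (K33 true 02614557) (On 2 8 (K33 true
  02614558) (On 2 6 (Earlier 35 false 201468753) (On 3 6 (On 1 7 (K33 true 0162355764) (On 1 8 (K33 true
  0162355864) (On 3 7 (Earlier 140 false 263140578) (Earlier 105 false 063451728)))) (On 3 7 (On 4 7 (K33 true
  0172355664) (On 1 8 (On 4 8 (K33 true 068145) (K33 false 02437806)) (K33 false 024137081635))) (Earlier 68
  true 235678410)))))) (On 3 7 (Earlier 1 false 012345678) (On 3 8 (Earlier 1 false 012345687) (On 1 7 (On 2 6
  (Earlier 15 false 012345678) (On 3 6 (On 2 7 (Earlier 3 false 102376854) (On 4 7 (On 2 8 (K33 true 02714558)
  (K33 false 023478063531)) (K33 false 02436708))) (Earlier 35 true 325648710))) (Earlier 0 false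
  012345678)))));
Entry 0102120313042405 231434 (On 1 5 (Earlier 69 false 012358764) (On 2 5 (Earlier 69 false 021458763) (On 3
  5 (Earlier 4 false 012345678) (On 4 5 (Earlier 4 false 021435876) (On 0 6 (Earlier 3 false 012345678) (On 5
  6 (On 0 7 (Earlier 3 false 012345786) (On 5 7 (On 0 8 (Earlier 3 false 012345876) (On 5 8 (On 1 6 (Earlier 0
  false 012345678) (On 2 6 (Earlier 0 false 021435678) (On 1 7 (Earlier 0 false 012345768) (On 2 7 (Earlier 0
  false 021435768) (On 3 8 (On 4 8 (On 3 6 (On 4 6 (K33 true 068345) (On 3 7 (On 4 7 (K33 true 078345) (K33
  false 12436705)) (K33 false 1362470580))) (Earlier 106 false 083451627)) (K33 false 0124670863)) (K33 false
  0123670834)))))) (Earlier 3 true 534210876))) (Earlier 3 true 534210786))) (Earlier 3 true 534210687)))))));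
Entry 010212031304241525 231434050607 (On 3 5 (Earlier 37 false 102358764) (On 4 5 (Earlier 37 false
  201458763) (On 1 6 (Earlier 0 false 102356874) (On 2 6 (Earlier 0 false 201456873) (On 1 7 (Earlier 0 false
  102357864) (On 2 7 (Earlier 0 false 201457863) (K33 false 0123670534)))))));
Entry 0112030424153545 230616360717370818 (On 2 8 (On 3 8 (K33 true 02513448) (K33 false 013678)) (K33 false
  01367882));
Entry 011203042415354526 2314340525061607170818 (On 3 6 (K33 true 02513446) (On 3 7 (On 2 7 (K33 true
  02513447) (On 6 7 (K33 true 0251344647) (K33 false 037126081534))) (Earlier 0 false 012345678)));
Entry 0102120304241535 23143405254506162607170818 (On 2 7 (On 3 7 (On 2 8 (On 4 7 (Earlier 3 false 204178653)
  (On 4 8 (On 5 8 (K33 true 0251344788) (K33 false 012456074863)) (K33 false 0146786362))) (K33 false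
  0124680563)) (K33 false 0243560781)) (K33 false 0124670563));
Entry 010212031304241535 2314340525060708 (On 1 6 (Earlier 4 false 103256874) (On 1 7 (Earlier 4 false
  103257864) (On 1 8 (Earlier 4 false 103258764) (On 4 5 (On 2 6 (Earlier 1 false 012345678) (On 2 7 (Earlier
  1 false 012345768) (Earlier 2 false 103254678))) (On 2 6 (On 3 6 (On 2 7 (On 4 6 (Earlier 4 false 204167853)
  (On 4 7 (Earlier 4 false 204176853) (Earlier 147 false 134052678))) (Earlier 0 false 012345768)) (Earlier 0
  false 103254678)) (Earlier 0 false 012345678))))));
Entry 010212031315 2314340525350626360727 (On 1 7 (On 3 7 (Earlier 5 false 103275864) (K33 false 023567)) (K33
  false 0235678481));
Entry 01021203130424154516 231434052535060708 (On 2 6 (Earlier 5 false 012346578) (On 3 6 (Earlier 6 false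
  103265874) (On 5 6 (On 2 7 (On 1 7 (Earlier 5 false 012347568) (On 4 7 (Earlier 1 false 021437568) (On 2 8
  (On 1 8 (Earlier 5 false 012348567) (On 4 8 (Earlier 6 false 204187653) (On 4 6 (Earlier 231 false
  140256378) (On 3 7 (On 5 7 (K33 true 01723524) (On 6 7 (K33 true 0172352486) (K33 false 027156083334)))
  (Earlier 6 true 326547810))))) (Earlier 0 false 012345687)))) (Earlier 0 false 012345678)) (Earlier 115 true
  235687410))));
Entry 02120313041545 23143405253506162607170818 (On 2 7 (On 2 8 (On 3 7 (Earlier 19 false 012346578) (Earlier
  20 false 012346578)) (K33 false 0123680534)) (K33 false 0123670534));
Entry 010212031304241545 231434052535060708 (On 1 6 (Earlier 1 false 012345678) (On 1 7 (Earlier 1 false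
  012345768) (On 1 8 (Earlier 1 false 012345867) (On 2 6 (On 4 6 (Earlier 3 false 021436578) (On 2 7 (On 3 6
  (Earlier 1 false 021436758) (On 5 6 (Earlier 24 false 120635478) (Earlier 8 true 634510872))) (Earlier 0
  false 012345768))) (Earlier 0 false 012345678)))));
Entry 010212031304241516 23143405253545060708 (On 2 6 (Earlier 8 false 012346578) (On 3 6 (Earlier 9 false
  103265874) (On 4 6 (Earlier 0 false 012346578) (On 5 6 (Earlier 46 true 325648710) (Earlier 118 true
  235687410)))));
Entry 0102120313042415 23143405060708 (On 2 5 (Earlier 9 false 012345678) (On 3 5 (Earlier 5 false 012345678)
  (On 4 5 (Earlier 1 false 012345678) (On 1 6 (Earlier 0 false 012345678) (On 1 7 (Earlier 0 false 012345768)
  (On 1 8 (Earlier 0 false 012345867) (On 2 6 (On 4 6 (Earlier 5 false 021436578) (On 3 6 (Earlier 1 false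
  021436578) (On 2 7 (Earlier 0 false 021436758) (K33 false 0243570681)))) (On 2 7 (On 3 7 (On 2 8 (On 4 7
  (Earlier 10 false 204178653) (Earlier 1 false 021437568)) (K33 false 0123680534)) (K33 false 0243560781))
  (K33 false 0123670534)))))))));
Entry 01021203130424 2314 (On 3 4 (Earlier 48 false 012345678) (On 0 5 (Earlier 11 false 012345678) (On 0 6
  (Earlier 11 false 012346875) (On 0 7 (Earlier 11 false 012347865) (On 0 8 (Earlier 11 false 012348765) (On 1
  5 (Earlier 0 false 012345678) (On 2 5 (Earlier 0 false 021435678) (On 1 6 (Earlier 0 false 012346578) (On 2
  6 (Earlier 0 false 021436578) (On 3 7 (On 4 7 (On 3 8 (On 4 8 (On 1 7 (Earlier 0 false 012347568) (On 2 7
  (On 1 8 (K33 true 01723458) (On 2 8 (K33 true 078234) (K33 false 012568))) (K33 false 012567))) (K33 false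
  0124560863)) (K33 false 0123560834)) (K33 false 0124560763)) (K33 false 0123560734)))))))))));
Entry 010212031306 23142434152535 (On 1 6 (Earlier 82 false 012368754) (On 2 6 (Earlier 0 false 012368754) (On
  3 6 (Earlier 0 false 013268754) (K33 false 123456))));
Entry 01021203134516 232434253506 (On 2 6 (Earlier 1 false 102368754) (On 3 6 (Earlier 1 false 103268754)
  (Earlier 83 true 234568710)));
Entry 0203040545 2314243415253506162607170818 (On 3 6 (On 3 7 (On 3 8 (On 4 6 (On 5 6 (On 2 7 (On 4 7 (Earlier
  218 true 813476025) (Earlier 16 false 025143768)) (Earlier 1 true 234506781)) (Earlier 2 true 235468710))
  (Earlier 2 true 234568710)) (K33 false 1234568880)) (K33 false 1234568780)) (K33 false 123456));
Entry 0102120313040526364627372838 141506160708 (On 4 7 (K33 true 067234) (On 5 7 (K33 true 0231671425) (On 4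
  8 (K33 true 068234) (On 5 8 (K33 true 0231681425) (K33 false 04517806)))));
Entry 01021203130405 23142434 (On 1 5 (Earlier 86 false 012358764) (On 2 5 (Earlier 4 false 012358764) (On 3 5
  (Earlier 4 false 013258764) (On 4 5 (On 0 6 (Earlier 3 false 012345678) (On 0 7 (Earlier 3 false 012345786)
  (On 0 8 (Earlier 3 false 012345876) (On 1 6 (Earlier 2 false 012345678) (On 1 7 (Earlier 2 false 012345786)
  (On 1 8 (Earlier 2 false 012345876) (On 2 6 (On 3 6 (On 2 7 (On 3 7 (On 2 8 (On 3 8 (On 4 6 (Earlier 0 false
  012345678) (On 5 6 (Earlier 0 false 012354678) (On 4 7 (Earlier 0 false 012345768) (On 5 7 (On 4 8 (K33 true
  0231781524) (K33 false 014678)) (K5 false 145674290))))) (Earlier 1 false 013245867)) (Earlier 1 false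
  012345867)) (Earlier 1 false 013245768)) (Earlier 1 false 012345768)) (Earlier 1 false 013245678)) (Earlier
  1 false 012345678)))))))) (Earlier 125 true 234587610)))));
Entry 01021203130415 2314243405060708 (On 2 5 (Earlier 5 false 102358764) (On 3 5 (Earlier 5 false 103258764)
  (On 4 5 (On 1 6 (Earlier 0 false 102356874) (On 1 7 (Earlier 0 false 102357864) (On 1 8 (Earlier 0 false
  102358764) (On 2 6 (On 3 6 (On 4 6 (K33 true 01623455) (On 2 7 (On 3 7 (On 4 7 (K33 true 01723455) (On 2 8
  (On 3 8 (On 4 8 (K33 true 01823455) (K33 false 014678)) (K33 false 0146788283)) (K33 false 01467882)))
  (Earlier 9 false 013245768)) (Earlier 9 false 012345768))) (Earlier 9 false 013245678)) (Earlier 9 false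
  012345678))))) (Earlier 126 true 234587610))));
Entry 010203042535452636 23142434051506160717 (On 4 6 (K33 true 056234) (On 5 6 (On 5 7 (Earlier 1 false
  562347810) (On 4 7 (On 6 7 (K33 true 05623487) (Earlier 6 true 167458320)) (Earlier 6 true 715408632)))
  (Earlier 6 true 615408732)));
Entry 0102030425354526 231424340515061607170818 (On 3 6 (Earlier 0 false 012345678) (On 3 7 (On 2 7 (Earlier 0
  false 012345768) (On 2 8 (On 3 8 (On 4 8 (K33 true 058234) (K33 false 0124670873)) (K33 false 0132680734))
  (K33 false 0123780634))) (Earlier 194 false 230154678)));
Entry 020304 23142405154506162607170818 (On 2 7 (On 3 7 (On 4 7 (On 2 8 (On 3 8 (On 4 8 (K33 true 078234) (K33
  false 01456872)) (K33 false 0124680583)) (K33 false 01246805)) (K33 false 01456772)) (K33 false 0124670583))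
  (K33 false 01246705));
Entry 010203042535 231424340515061607170818 (On 4 5 (On 2 6 (Earlier 1 false 012345678) (On 3 6 (Earlier 1
  false 013245678) (On 4 6 (On 2 7 (Earlier 1 false 012345768) (Earlier 311 false 423506178)) (Earlier 130
  true 234687510)))) (On 2 6 (On 3 6 (On 4 6 (Earlier 2 false 012346578) (On 2 7 (On 3 7 (On 4 7 (On 2 8 (On 3
  8 (On 4 8 (K33 true 078234) (K33 false 014568)) (K33 false 0145688283)) (K33 false 01456882)) (K33 false
  014567)) (K33 false 0145678283)) (K33 false 01456782))) (Earlier 0 false 013245678)) (Earlier 0 false
  012345678)));
Entry 01020304 23142434051535061607170818 (On 4 7 (On 4 8 (On 2 6 (On 3 6 (Earlier 0 false 012346578) (On 2 7
  (On 3 7 (On 2 8 (On 3 8 (K33 true 078234) (K33 false 013568)) (K33 false 0132560834)) (K33 false 013567))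
  (K33 false 0132560734))) (On 2 7 (On 3 7 (On 2 8 (On 3 8 (K33 true 078234) (K33 false 0132580634)) (K33
  false 0123680534)) (K33 false 0132570634)) (K33 false 0123670534))) (Earlier 1 false 013248567)) (Earlier 1
  false 013247568));
Entry 010212031304 23 (On 1 4 (Earlier 93 false 012345678) (On 2 4 (Earlier 11 false 012345678) (On 3 4
  (Earlier 11 false 013248765) (On 0 5 (Earlier 6 false 012345678) (On 0 6 (Earlier 6 false 012346875) (On 0 7
  (Earlier 6 false 012347865) (On 0 8 (Earlier 6 false 012348765) (On 1 5 (Earlier 5 false 012345678) (On 1 6
  (Earlier 5 false 012346578) (On 1 7 (Earlier 5 false 012347568) (On 1 8 (Earlier 5 false 012348567) (On 2 5
  (On 3 5 (Earlier 1 false 012345678) (Earlier 0 false 012345678)) (Earlier 0 false 013245678)))))))))))));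
Entry 010224342535 2304140515061607170818 (On 4 5 (On 4 6 (Earlier 0 false 452368710) (On 2 6 (On 5 6 (Earlier
  0 false 254608731) (Earlier 0 true 064578321)) (Earlier 0 true 640128753))) (On 4 6 (On 5 6 (On 2 6 (Earlier
  0 false 264508731) (On 4 7 (On 5 7 (On 2 7 (Earlier 0 false 274508631) (On 2 8 (On 3 8 (On 6 8 (K33 true
  236458) (On 7 8 (K33 true 237458) (K5 false 016780472))) (K33 false 01267883)) (K33 false 012678))) (Earlier
  0 true 054768321)) (Earlier 0 true 450178632))) (Earlier 0 true 054678321)) (Earlier 0 true 450168732)));
Entry 01022434 230414051535061607170818 (On 4 5 (On 5 7 (On 5 8 (On 2 6 (On 3 6 (Earlier 0 false 012346578)
  (On 2 7 (On 3 7 (On 2 8 (On 3 8 (K33 true 235478) (K33 false 013568)) (K33 false 01356882)) (K33 false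
  013567)) (K33 false 01356782))) (On 2 7 (On 3 7 (On 2 8 (On 3 8 (K33 true 235478) (K33 false 01356872)) (K33
  false 01256863)) (K33 false 01356772)) (K33 false 01256763))) (Earlier 1 true 580137642)) (Earlier 1 true
  570138642)) (Earlier 1 true 540138762));
Entry 0102 230414340515061607170818 (On 4 6 (On 4 7 (On 4 8 (On 2 5 (On 3 5 (Earlier 0 false 012354678) (On 2
  6 (On 3 6 (On 2 7 (On 3 7 (On 2 8 (On 3 8 (K33 true 234678) (K33 false 013458)) (K33 false 01345882)) (K33
  false 013457)) (K33 false 01345782)) (K33 false 013456)) (K33 false 01345682))) (On 2 6 (On 3 6 (On 2 7 (On
  3 7 (On 2 8 (On 3 8 (K33 true 234678) (K33 false 01345872)) (K33 false 01245863)) (K33 false 01345772)) (K33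
  false 01245763)) (K33 false 01345672)) (K33 false 01245663))) (Earlier 2 true 480137652)) (Earlier 2 true
  470138652)) (Earlier 2 true 460138752));
Entry 0102120313 no_pair (On 2 3 (Earlier 136 false 012345678) (On 0 4 (Earlier 3 false 012345678) (On 1 4
  (Earlier 3 false 102348765) (On 0 5 (Earlier 3 false 012358764) (On 1 5 (Earlier 3 false 102358764) (On 0 6
  (Earlier 3 false 012368754) (On 1 6 (Earlier 3 false 102368754) (On 0 7 (Earlier 3 false 012378654) (On 1 7
  (Earlier 3 false 102378654) (On 0 8 (Earlier 3 false 012387654) (On 1 8 (Earlier 3 false 102387654) (On 2 4
  (On 3 4 (On 2 5 (On 3 5 (Earlier 2 false 012345678) (Earlier 1 false 012345678)) (Earlier 1 false
  013245678)) (Earlier 0 false 012345678)) (Earlier 0 false 013245678)))))))))))));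
Entry 01021203043405 1323 (On 1 5 (Earlier 0 false 012587643) (On 2 5 (Earlier 0 false 021587643) (On 3 5
  (Earlier 0 false 034587621) (Earlier 0 true 351287640))));
Entry 010212030434153516 13231424052545060708 (On 2 6 (Earlier 1 false 120687543) (On 4 6 (On 3 6 (Earlier 1
  false 340687521) (On 5 6 (On 1 7 (Earlier 0 false 156027843) (On 2 7 (On 1 8 (Earlier 0 false 156028743) (On
  3 7 (On 4 7 (K33 true 0172344556) (On 6 7 (K33 true 0172362445) (K33 false 024156083387))) (On 4 7 (On 5 7
  (K33 true 0172452346) (K33 false 034125081657)) (K33 false 0341270815)))) (K33 false 0123470615))) (Earlier
  1 true 254687310))) (Earlier 1 true 245687310)));
Entry 0102120304341535 132314240525060708 (On 4 5 (Earlier 2 false 340587621) (On 1 6 (Earlier 0 false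
  012345678) (On 3 6 (Earlier 0 false 034125678) (On 2 6 (On 4 6 (On 1 7 (Earlier 0 false 012345768) (On 2 7
  (Earlier 0 false 021436758) (K33 false 0123470615))) (Earlier 2 true 163487520)) (Earlier 2 true
  361287540)))));
Entry 01021203043415 1323142405060708 (On 2 5 (Earlier 3 false 120587643) (On 3 5 (Earlier 0 false 012345678)
  (On 4 5 (Earlier 0 false 012435678) (Earlier 3 true 253487610))));
Entry 0102120304 1323 (On 1 4 (Earlier 4 false 012487653) (On 2 4 (Earlier 4 false 021487653) (On 3 4 (On 0 5
  (Earlier 3 false 012345678) (On 0 6 (Earlier 3 false 034126875) (On 0 7 (Earlier 3 false 034127865) (On 0 8
  (Earlier 3 false 034128765) (On 1 5 (Earlier 0 false 012345678) (On 2 5 (Earlier 0 false 021345678) (On 3 5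
  (Earlier 0 false 034125678) (Earlier 4 true 351287640)))))))) (Earlier 4 true 341287650))));
Entry 01021214 0405060708 (On 2 4 (Earlier 5 false 120487653) (On 1 5 (Earlier 0 false 102458763) (On 1 6
  (Earlier 0 false 102468753) (On 5 6 (On 1 7 (Earlier 0 false 102478653) (On 5 7 (On 6 7 (On 1 8 (Earlier 0
  false 102487653) (On 5 8 (On 6 8 (Earlier 5 false 567843210) (Earlier 5 true 680175432)) (Earlier 5 true
  580176432))) (Earlier 5 true 670185432)) (Earlier 5 true 570186432))) (Earlier 5 true 560187432)))));
Entry 01021203 no_pair (On 1 3 (Earlier 6 false 012345678) (On 2 3 (Earlier 6 false 021387654) (On 0 4
  (Earlier 1 false 012345678) (On 0 5 (Earlier 1 false 012358764) (On 0 6 (Earlier 1 false 012368754) (On 0 7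
  (Earlier 1 false 012378654) (On 0 8 (Earlier 1 false 012387654) (On 1 4 (Earlier 0 false 012345678) (On 2 4
  (Earlier 0 false 021345678) (On 3 4 (On 1 5 (Earlier 0 false 012354678) (On 2 5 (Earlier 0 false 021354678)
  (On 3 6 (On 3 5 (On 4 5 (Earlier 1 false 345068721) (Earlier 6 true 450187632)) (Earlier 6 true 351287640))
  (K33 false 01234506)))) (Earlier 6 true 341287650)))))))))));
Entry 010212 no_pair (On 0 3 (Earlier 0 false 012345678) (On 1 3 (Earlier 0 false 102387654) (On 2 3 (Earlier
  0 false 201387654) (On 0 4 (Earlier 0 false 012487653) (On 1 4 (Earlier 0 false 102487653) (On 2 4 (Earlier
  0 false 201487653) (On 0 5 (Earlier 0 false 012587643) (On 1 5 (Earlier 0 false 102587643) (On 2 5 (Earlier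
  0 false 201587643) (K33 false 012345))))))))));
Entry 010203 12 (On 1 3 (Earlier 0 false 013876542) (On 2 3 (Earlier 0 false 023876541) (Earlier 0 true
  123876540)));
Entry 0102 no_pair (On 1 2 (Earlier 1 false 012345678) (On 0 3 (Earlier 0 false 012345678) (On 0 4 (Earlier 0
  false 012487653) (On 3 4 (On 0 5 (Earlier 0 false 012587643) (Earlier 0 true 034587621)) (Earlier 1 true
  034876521)))));
Entry 01 no_pair (On 0 2 (Earlier 0 false 012345678) (On 1 2 (Earlier 0 false 102876543) (Earlier 0 true
  201876543)))].

Definition catalogue_root : refutation :=
  On 0 1 (Earlier 0 false 012345678) (Earlier 0 true 018765432).

Lemma catalogue_valid : valid [::] catalogue catalogue_root.
Proof. by vm_compute. Qed.

(** The graph-theoretic core, with planarity weakened to the vanishing of the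
    obstruction. *)
Lemma not_biplanar9 (V : finType) (e : rel V) : symmetric e -> 9 <= #|V| ->
  van_kampen_trivial e -> van_kampen_trivial (fun u v => ~~ e u v) -> False.
Proof.
move=> e_sym V9 triv triv'.
have [v0 _] : {v : V | v \in V} by apply/sigW/card_gt0P; apply: leq_trans V9.
have triv_c c : van_kampen_trivial (fun u v => e u v == c).
  case: c; [apply: van_kampen_trivial_inj triv|apply: van_kampen_trivial_inj triv'];
  by [exact: inj_id|move=> a b _ /eqP ->].
apply: (valid_avoided e_sym triv_c (known := [::]) _ catalogue_valid
  (h := nth v0 (enum V)) (flip := false)) => [[]//|].
split=> [i j i9 j9|i j c]; last by rewrite /color_of !nth_nil.
have lt k : k \in gtn 9 -> k < size (enum V) by move=> k9; rewrite -cardE (leq_trans k9).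
by move/eqP; rewrite nth_uniq ?enum_uniq ?lt // => /eqP.
Qed.

(** * Parity of crossings of a half-axis *)

Local Open Scope ring_scope.

Section Crossing.
Variable R : realType.
Implicit Types z w u : R * R.

Definition dot z w := z.1 * w.1 + z.2 * w.2.
Definition det z w := z.1 * w.2 - z.2 * w.1.
Definition upper z := (0 < z.2) || (z.2 == 0) && (0 < z.1).
(** Whether the segment from z to w crosses the positive horizontal half-axis,
    provided that z and w lie in a common open half-plane with 0 on its
    boundary; the half-axis itself counts as being in the upper half. *)
Definition crosses z w := (upper z (+) upper w) && (upper w == (0 < det z w)).

Lemma upperN z : z != 0 -> upper (- z) = ~~ upper z.
Proof.
case: z => x y; rewrite /upper /= oppr_gt0 oppr_eq0 oppr_gt0.
case: (ltgtP y 0) => //= -> nz.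
by case: (ltgtP x 0) => //= x0; move: nz; rewrite x0 eqxx.
Qed.

(** The segment from z to w meets the horizontal axis at a positive multiple of
    (det z w, 0), which is on the same side as z and w of the line orthogonal
    to u. *)
Lemma upper_neq_det u z w : 0 < dot u z -> 0 < dot u w ->
  ~~ upper z -> upper w -> 0 < u.1 * det z w.
Proof.
case: u z w => [a b] [x y] [x' y']; rewrite /dot /upper /det /=.
rewrite negb_or negb_and -!leNgt => hz hw /andP[y0 xy] yx.
have [y0'|y0'] : y = 0 \/ y < 0 by move: y0; rewrite le_eqVlt => /predU1P[]; auto.
  have x0 : x <= 0 by move: xy; rewrite y0' eqxx.
  case/orP: yx => [y1|/andP[/eqP y1 x1]]; first by rewrite y0' in hz *; nra.
  by rewrite y0' in hz *; rewrite y1 in hw *; nra.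
have y1 : 0 <= y' by case/orP: yx => [/ltW|/andP[/eqP ->]].
nra.
Qed.

(** Within a half-plane, crossings are the differences of one function of the
    end points, hence cancel around any closed polygon. *)
Lemma crosses_half_plane u z w : 0 < dot u z -> 0 < dot u w ->
  crosses z w = (0 < u.1) && (upper z (+) upper w).
Proof.
move=> hz hw; rewrite /crosses andbC.
case uz: (upper z); case uw: (upper w); rewrite ?andbF //= !andbT.
  have := upper_neq_det hw hz (negbT uw) uz.
  have -> : det w z = - det z w by rewrite /det; ring.
  by move=> h; case: (ltgtP 0 (det z w)); case: (ltgtP 0 u.1) => // *; nra.
have := upper_neq_det hz hw (negbT uz) uw.
by move=> h; case: (ltgtP 0 (det z w)); case: (ltgtP 0 u.1) => // *; nra.
Qed.

(** A segment that changes between upper and lower half crosses exactly one of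
    the two horizontal half-axes. *)
Lemma crossesN u z w : 0 < dot u z -> 0 < dot u w ->
  crosses (- z) (- w) = crosses z w (+) (upper z (+) upper w).
Proof.
move=> hz hw.
have dotNN v : dot (- u) (- v) = dot u v by rewrite /dot /=; ring.
have nz v : 0 < dot u v -> v != 0.
  by apply: contraTneq => ->; rewrite /dot /= !mulr0 addr0 ltxx.
rewrite (@crosses_half_plane (- u)) ?dotNN // (crosses_half_plane hz hw).
rewrite !upperN ?nz //= oppr_gt0 addNb addbN negbK.
case uz: (upper z); case uw: (upper w); rewrite ?andbF //= !andbT.
  by have := upper_neq_det hw hz (negbT uw) uz; case: (ltgtP 0 u.1) => // <-; rewrite mul0r ltxx.
by have := upper_neq_det hz hw (negbT uz) uw; case: (ltgtP 0 u.1) => // <-; rewrite mul0r ltxx.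
Qed.

Lemma addb_telescope (f : nat -> bool) N :
  \big[addb/false]_(i < N) (f i (+) f i.+1) = f 0%N (+) f N.
Proof.
elim: N => [|N IH]; first by rewrite big_ord0 addbb.
by rewrite big_ord_recr /= IH -addbA addKb.
Qed.

(** On a closed path this is the winding number around 0, mod 2. *)
Definition winding (N : nat) (z : nat -> R * R) : bool :=
  \big[addb/false]_(i < N) crosses (z i) (z i.+1).

Lemma windingN N (z : nat -> R * R) :
  (forall i, (i < N)%N -> exists u, 0 < dot u (z i) /\ 0 < dot u (z i.+1)) ->
  winding N (fun i => - z i) = winding N z (+) (upper (z 0%N) (+) upper (z N)).
Proof.
move=> h; rewrite -(addb_telescope (upper \o z)) -big_split /=.
by apply: eq_bigr => i _; have [u [? ?]] := h i (ltn_ord i); apply: (@crossesN u).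
Qed.

(** A grid of nonzero vectors, fine enough for the corners of each cell to share
    a half-plane: every cell has an even number of crossings on its boundary,
    and inner sides are counted twice. *)
Lemma winding_square N (z : nat -> nat -> R * R) :
  (forall i j, (i < N)%N -> (j < N)%N -> exists u,
     [/\ 0 < dot u (z i j), 0 < dot u (z i.+1 j),
         0 < dot u (z i j.+1) & 0 < dot u (z i.+1 j.+1)]) ->
  winding N (z^~ 0%N) (+) winding N (z^~ N) = winding N (z 0%N) (+) winding N (z N).
Proof.
move=> h.
rewrite -(addb_telescope (fun j => winding N (z^~ j))).
rewrite /winding -big_split /=; apply: eq_bigr => j _.
rewrite -big_split -(addb_telescope (fun i => crosses (z i j) (z i j.+1))) /=.
apply: eq_bigr => i _; have [u [? ? ? ?]] := h i j (ltn_ord i) (ltn_ord j).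
rewrite !(@crosses_half_plane u) //.
by case: (0 < u.1); case: upper; case: upper; case: upper; case: upper.
Qed.

End Crossing.

(** * Fine grids *)

Section Arcs.
Variable R : realType.
Implicit Types f g : R -> R * R.

Definition grid_separated N f g := forall i j, (i < N)%N -> (j < N)%N -> exists u,
  forall s t, s \in [:: i%:R / N%:R; i.+1%:R / N%:R] ->
    t \in [:: j%:R / N%:R; j.+1%:R / N%:R] -> 0 < dot u (f s - g t).

Lemma cvg_dot u f (s : R) : {within `[0, 1]%classic, continuous f}%classic -> 0 <= s <= 1 ->
  (dot u (f x) @[x --> within `[0, 1] (nbhs s)] --> dot u (f s))%classic.
Proof.
move=> cf hs.
have {}cf : (f x @[x --> within `[0, 1] (nbhs s)] --> f s)%classic.
  by move/subspace_continuousP : cf; apply; rewrite /= in_itv.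
rewrite /dot; apply: cvgD; apply: cvgM; try exact: cvg_cst.
  exact: (cvg_comp _ _ cf cvg_fst).
exact: (cvg_comp _ _ cf cvg_snd).
Qed.

(** Around (s0, t0) the difference f s - g t stays in the half-plane of vectors
    with positive product with its value at (s0, t0); by compactness of the
    square a uniform mesh suffices. *)
Lemma grid_separation f g :
  {within `[0, 1]%classic, continuous f}%classic ->
  {within `[0, 1]%classic, continuous g}%classic ->
  (forall s t : R, 0 <= s <= 1 -> 0 <= t <= 1 -> f s != g t) ->
  \forall N \near \oo%classic, grid_separated N f g.
Proof.
move=> cf cg dis.
(* [near_covering] is compactness in the form: local validity near each point,
   eventually in N, gives validity on the whole square, eventually in N. *)
have cK := compact_setX (@segment_compact R 0 1) (@segment_compact R 0 1).
pose P (N : nat) (x : R * R) := exists u, forall s t : R, 0 <= s <= 1 -> 0 <= t <= 1 ->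
  `|s - x.1| <= N%:R^-1 -> `|t - x.2| <= N%:R^-1 -> 0 < dot u (f s - g t).
have : \forall N \near \oo%classic, (`[0, 1] `*` `[0, 1] `<=` P N)%classic.
  move/compact_near_coveringP: cK; apply.
  move=> [s0 t0] [/=]; rewrite !in_itv /= => hs0 ht0.
  pose u := f s0 - g t0.
  have u0 : 0 < dot u u.
    have : u != 0 by rewrite subr_eq0 dis.
    case: (u) => a b nz; rewrite /dot /= -!expr2.
    rewrite lt_neqAle addr_ge0 ?sqr_ge0 // andbT eq_sym paddr_eq0 ?sqr_ge0 //.
    by rewrite !sqrf_eq0.
  have dotB a b : dot u (a - b) = dot u a - dot u b by rewrite /dot /=; ring.
  have uE : dot u u = dot u (f s0) - dot u (g t0) by rewrite -dotB.
  clearbody u.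
  have near1 (h : R -> R * R) (s : R) : {within `[0, 1]%classic, continuous h}%classic -> 0 <= s <= 1 ->
      exists2 e, 0 < e & forall x, `|x - s| < e -> 0 <= x <= 1 ->
        `|dot u (h x) - dot u (h s)| < dot u u / 2.
    move=> ch hs; have := cvg_dot (u := u) ch hs.
    move/cvgr_dist_lt => /(_ (dot u u / 2)); rewrite divr_gt0 // => /(_ isT).
    rewrite near_withinE => /nbhs_ballP[e /= e0 he]; exists e => // x xs x01.
    by rewrite distrC; apply: he; rewrite /= ?in_itv //= -ball_normE /= distrC.
  have [e e0 he] := near1 f s0 cf hs0.
  have [e' e'0 he'] := near1 g t0 cg ht0.
  have [m m0 [me me']] : exists2 m : R, 0 < m & 2 * m <= e /\ 2 * m <= e'.
    exists (Num.min e e' / 2); first by rewrite divr_gt0 // lt_min e0.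
    by rewrite mulrC divfK // !ge_min !lexx orbT.
  near=> x N; exists u => s t hs ht sx tx.
  have hN : N%:R^-1 < m :> R.
    rewrite invf_plt ?posrE //; last by rewrite ltr0n; near: N; exact: nbhs_infty_gt.
    by near: N; exact: nbhs_infty_gtr.
  have [x1 x2] : `|x.1 - s0| < m /\ `|x.2 - t0| < m.
    near: x; apply/nbhs_ballP; exists m => //= y [/= y1 y2].
    by move: y1 y2; rewrite -!ball_normE /= !(distrC _ y.1) !(distrC _ y.2).
  have hs0' : `|s - s0| < e.
    by rewrite (le_lt_trans (ler_distD x.1 _ _)) //; lra.
  have ht0' : `|t - t0| < e'.
    by rewrite (le_lt_trans (ler_distD x.2 _ _)) //; lra.
  have := he s hs0' hs; have := he' t ht0' ht; rewrite !ltr_norml => /andP[? ?] /andP[? ?].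
  by rewrite dotB; lra.
apply: filterS2 (nbhs_infty_gt 0) => N N0 hP i j iN jN.
have N0' : 0 < N%:R :> R by rewrite ltr0n.
have bound k : (k < N)%N -> (0 <= (k%:R / N%:R : R) <= 1) /\ (0 <= (k.+1%:R / N%:R : R) <= 1).
  by move=> kN; rewrite !divr_ge0 // !ler_pdivrMr // !mul1r !ler_nat kN ltnW.
have [? ?] := bound _ iN; have [? ?] := bound _ jN.
have [|u hu] := hP (i%:R / N%:R, j%:R / N%:R); first by split; rewrite /= in_itv.
exists u => s t; rewrite !inE => hs ht.
have near_pt k (x : R) : x = k%:R / N%:R \/ x = k.+1%:R / N%:R -> `|x - k%:R / N%:R| <= N%:R^-1.
  case=> ->; first by rewrite subrr normr0 invr_ge0 ltW.
  by rewrite -mulrBl -natrB // subSnn mul1r ger0_norm // invr_ge0 ltW.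
apply: hu; [by case/orP: hs => /eqP -> | by case/orP: ht => /eqP -> | |].
  by apply: near_pt; case/orP: hs => /eqP; auto.
by apply: near_pt; case/orP: ht => /eqP; auto.
Unshelve. all: by end_near.
Qed.
End Arcs.

(** * Plane drawings *)

Section Drawings.
Variables (R : realType) (V : finType) (G : sgraph V).
Variables (p : V -> R * R) (a : {set V} -> R -> R * R).
Hypothesis drawing : plane_drawing G p a.

Lemma arc_endpoint e s : e \in edges G -> 0 <= s <= 1 ->
  (exists2 v, v \in e & a e s = p v) \/ (forall v, a e s <> p v).
Proof.
move=> eE s01; have [_ /(_ e eE)[_ _ ends] avoid _] := drawing.
have [si|] := boolP (s \in `]0, 1[); first by right=> v; exact: avoid.
rewrite in_itv /= negb_and -!leNgt => sb; left.
have : (a e s \in [set a e 0; a e 1])%classic.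
  rewrite inE /=; move: s01 sb => /andP[s0 s1] /orP[s0'|s1']; [left|right];
  by congr (a e _); lra.
by rewrite ends inE => -[v ve <-]; exists v.
Qed.

Lemma arcs_disjoint e e' s t : e \in edges G -> e' \in edges G ->
  [disjoint e & e']%SET -> 0 <= s <= 1 -> 0 <= t <= 1 -> a e s != a e' t.
Proof.
move=> eE eE' dis s01 t01; apply/eqP => st.
have [pinj _ avoid cross] := drawing.
have [[v ve av]|sv] := arc_endpoint eE s01; last first.
  have [[v ve av]|tv] := arc_endpoint eE' t01; first by apply: (sv v); rewrite st.
  have interior f r : f \in edges G -> 0 <= r <= 1 -> (forall v, a f r <> p v) -> r \in `]0, 1[.
    move=> fE r01 rv; have [_ /(_ f fE)[_ _ ends] _ _] := drawing.
    have ne r' : r' = 0 \/ r' = 1 -> r != r'.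
      move=> r'01; apply/eqP => rr'; subst r'.
      have : (a f r \in [set a f 0; a f 1])%classic by rewrite inE /=; case: r'01 => ->; auto.
      by rewrite ends inE => -[v _ /esym]; exact: rv.
    move: r01; rewrite in_itv /= !le_eqVlt => /andP[].
    by rewrite eq_sym !(negPf (ne _ _)); auto => /= -> ->.
  apply: (cross e e') st => //; [|exact: interior sv|exact: interior tv].
  apply: contraTneq dis => <-; rewrite -finset.setI_eq0 finset.setIid.
  have := fintype.subsetP (edges_card2 G) _ eE; rewrite inE => e2.
  by rewrite -cards_eq0 (eqP e2).
have [[v' ve' av']|tv] := arc_endpoint eE' t01; last by apply: (tv v); rewrite -st.
move: st; rewrite av av' => /pinj vv'; move: dis; rewrite disjoint_subset => /fintype.subsetP/(_ v ve).
by rewrite inE vv' ve'.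
Qed.

Lemma arc_ends b c : [set b; c]%SET \in edges G ->
  (a [set b; c]%SET 0 = p b /\ a [set b; c]%SET 1 = p c) \/
  (a [set b; c]%SET 0 = p c /\ a [set b; c]%SET 1 = p b).
Proof.
move=> eE; have [pinj /(_ _ eE)[_ _ ends] _ _] := drawing.
have := fintype.subsetP (edges_card2 G) _ eE; rewrite inE cards2 => bc.
have {}bc : b != c by move: bc; case: (b != c).
set e := [set b; c]%SET in eE ends *.
have ext r : (a e r \in [set a e 0; a e 1])%classic -> a e r = p b \/ a e r = p c.
  by rewrite ends inE => -[v /=]; rewrite !inE => /orP[]/eqP -> <-; auto.
have hit v : v \in e -> p v = a e 0 \/ p v = a e 1.
  move=> ve; have : (p v \in [set p v | v in [set` e]])%classic by rewrite inE; exists v.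
  by rewrite -ends inE.
have pbc : p b <> p c by move/pinj/eqP; rewrite (negPf bc).
have h0 := ext 0 (mem_set (or_introl erefl)).
have h1 := ext 1 (mem_set (or_intror erefl)).
case: h0 => h0; case: h1 => h1; auto; exfalso.
  by have [] := hit c (set22 _ _); rewrite ?h0 ?h1 => /esym.
by have [] := hit b (set21 _ _); rewrite ?h0 ?h1.
Qed.

(** The boundary of the unit square, read through e(s) - f(t): the sides with t
    fixed see the arc of e from an end of f, those with s fixed see the arc of f
    from an end of e, but with the opposite sign, which [windingN] accounts for.
    Both sides of the equation are symmetric in the ends of each edge, so the
    direction in which an arc runs does not matter. *)
Lemma winding_drawing N b c b' c' :
  grid_separated N (a [set b; c]%SET) (a [set b'; c']%SET) -> (0 < N)%N ->
  [set b; c]%SET \in edges G -> [set b'; c']%SET \in edges G ->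
  let x w e := winding N (fun i => a e (i%:R / N%:R) - p w) in
  let tau v w := upper (p w - p v) in
  x b [set b'; c']%SET (+) x c [set b'; c']%SET (+) x b' [set b; c]%SET (+) x c' [set b; c]%SET
  = tau b b' (+) tau b c' (+) tau c b' (+) tau c c'.
Proof.
move=> sep N0 eE eE' /=.
set e := [set b; c]%SET in sep eE *; set e' := [set b'; c']%SET in sep eE' *.
pose z i j := a e (i%:R / N%:R) - a e' (j%:R / N%:R).
have : winding N (z^~ 0%N) (+) winding N (z^~ N) = winding N (z 0%N) (+) winding N (z N).
  apply: winding_square => i j iN jN.
  by have [u hu] := sep i j iN jN; exists u; split; apply: hu; rewrite !inE eqxx ?orbT.
have dotNB u v w : dot (- u) (v - w) = dot u (w - v) by rewrite /dot /=; ring.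
have col r : (r = 0%N) \/ (r = N) -> winding N (z r) =
    winding N (fun j => a e' (j%:R / N%:R) - a e (r%:R / N%:R)) (+)
    (upper (a e' 0 - a e (r%:R / N%:R)) (+) upper (a e' 1 - a e (r%:R / N%:R))).
  move=> hr; have := @windingN R N (fun j => a e' (j%:R / N%:R) - a e (r%:R / N%:R)).
  rewrite mul0r divff ?pnatr_eq0 -?lt0n // => <-.
    by rewrite /winding; apply: eq_bigr => j _; rewrite !opprB.
  move=> j jN; case: hr => ->.
    have [u hu] := sep 0%N j N0 jN; exists (- u).
    by rewrite !dotNB; split; apply: hu; rewrite !inE eqxx ?orbT.
  have N1 : (N.-1 < N)%N by rewrite prednK.
  have [u hu] := sep N.-1 j N1 jN; exists (- u).
  by rewrite !dotNB; split; apply: hu; rewrite !inE ?prednK // eqxx ?orbT.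
rewrite !col; auto.
rewrite /z !mul0r divff ?pnatr_eq0 -?lt0n //.
have [] := arc_ends eE => -[-> ->]; have [] := arc_ends eE' => -[-> ->];
by do 4! case: winding; do 4! case: upper.
Qed.
End Drawings.

(** The system is solved by the crossings, with the positive half-axis, of the
    arcs as seen from the vertices, and by the lexicographic order of the
    positions of the vertices, second coordinate first. *)
Lemma planar_van_kampen (R : realType) (V : finType) (G : sgraph V) :
  planar R G -> van_kampen_trivial (adj G).
Proof.
move=> [p [a draw]]; have [pinj arcs _ _] := draw.
(* One mesh has to serve all pairs of disjoint edges, since the unknown attached
   to a vertex and an edge must be the same in all equations. *)
have : \forall N \near \oo%classic, forall q : {set V} * {set V},
    q.1 \in edges G -> q.2 \in edges G -> [disjoint q.1 & q.2]%SET ->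
    grid_separated N (a q.1) (a q.2).
  apply: filter_forall => -[e e'] /=.
  have [eE|] := boolP (e \in edges G); last by move=> _; near=> N.
  have [eE'|] := boolP (e' \in edges G); last by move=> _; near=> N.
  have [dis|] := boolP [disjoint e & e']%SET; last by move=> _; near=> N.
  have [ce _ _] := arcs _ eE; have [ce' _ _] := arcs _ eE'.
  apply: filterS (grid_separation ce ce' _) => // s t.
  exact: (arcs_disjoint draw).
move=> /(filterI (nbhs_infty_gt 0)) /filter_ex[N [N0 sep]].
exists (fun v w => upper (p w - p v)),
  (fun w c d => winding N (fun i => a [set c; d]%SET (i%:R / N%:R) - p w)); split.
  move=> v w vw; rewrite -opprB upperN // subr_eq0.
  by apply: contra_neq vw => /pinj.
move=> b c b' c' /= u e1 e2.
have dis : [disjoint [set b; c] & [set b'; c']]%SET.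
  rewrite -finset.setI_eq0; apply/eqP/finset.setP => v; rewrite !inE; apply/negP.
  move: u; rewrite /= !inE !negb_or !andbT => /and3P[/and3P[_ bb bc] /andP[cb cc] _].
  by case/andP => /orP[]/eqP -> /orP[]; apply/negP.
exact: (winding_drawing draw (sep ([set b; c]%SET, [set b'; c']%SET) e1 e2 dis) N0).
Unshelve. all: by end_near.
Qed.

(** * Complements *)

Section Complement.
Variable V : finType.
Implicit Types G H : sgraph V.

Fact compl_edges_card2 G : ([set e : {set V} | #|e| == 2%N] :\: edges G)%SET \subset
  [set e : {set V} | #|e| == 2%N]%SET.
Proof. exact: subsetDl. Qed.

Definition compl G : sgraph V := SGraph (compl_edges_card2 G).

Lemma complK : involutive compl.
Proof.
move=> G; apply: val_inj; apply/finset.setP => e; rewrite !inE.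
have := fintype.subsetP (edges_card2 G) e; rewrite inE.
by case: (e \in edges G) => [-> //|_]; case: (_ == _).
Qed.

Lemma adj_compl G x y : x != y -> adj (compl G) x y = ~~ adj G x y.
Proof. by move=> xy; rewrite /adj !inE cards2 xy andbT. Qed.

Lemma adj_irr G x : adj G x x = false.
Proof.
apply/negP => /(fintype.subsetP (edges_card2 G)).
by rewrite inE finset.setUid cards1.
Qed.

Lemma compl_iso G H : sgraph_iso G H -> sgraph_iso (compl G) (compl H).
Proof.
move=> /existsP[s /'forall_'forall_eqP h]; apply/existsP; exists s.
apply/'forall_'forall_eqP => x y; have [->|xy] := eqVneq x y; first by rewrite !adj_irr.
by rewrite !adj_compl ?(inj_eq perm_inj) // h.
Qed.

Lemma not_apex_compl (R : realType) n G : (2 * n + 9 <= #|V|)%N ->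
  n_apex R n G -> ~ n_apex R n (compl G).
Proof.
move=> Vn [S Sn /planar_van_kampen plS] [S' S'n /planar_van_kampen plS'].
pose W := {x : V | x \notin S :|: S'}%SET.
have outS (w : W) : val w \notin S by have := valP w; rewrite !inE negb_or => /andP[].
have outS' (w : W) : val w \notin S' by have := valP w; rewrite !inE negb_or => /andP[].
have adj_del K (T : {set V}) (u v : {x | x \notin T}) :
    adj (del_vertices K T) u v = adj K (val u) (val v).
  by rewrite /adj inE imsetU1 imset_set1.
apply: (@not_biplanar9 W (fun u v => adj G (val u) (val v))).
- by move=> u v; rewrite /adj finset.setUC.
- have -> : #|{: W}| = #|~: (S :|: S')%SET|%SET.
    by rewrite card_sig; apply: eq_card => x; rewrite !inE.
  rewrite -(leq_add2l #|S :|: S'|%SET) cardsC (leq_trans _ Vn) // leq_add2r mul2n -addnn.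
  by apply: leq_trans (leq_add Sn S'n); rewrite cardsU leq_subr.
- apply: (van_kampen_trivial_inj (f := fun w : W => Sub (val w) (outS w))) plS.
    by move=> u v /(congr1 val) /= /val_inj.
  by move=> u v _; rewrite adj_del.
- apply: (van_kampen_trivial_inj (f := fun w : W => Sub (val w) (outS' w))) plS'.
    by move=> u v /(congr1 val) /= /val_inj.
  by move=> u v uv; rewrite adj_del /= adj_compl.
Qed.

End Complement.

(** * Counting *)

(** An injection from the complement of P into P bounds the former by the
    latter. *)
Lemma unif_prob_half (T : finType) (Omega : {set T}) (P : T -> Prop) (f : T -> T) :
  injective f -> (0 < #|Omega|)%N ->
  (forall x, x \in Omega -> ~ P x -> f x \in Omega /\ P (f x)) ->
  1 / 2 <= unif_prob Omega P.
Proof.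
move=> f_inj Omega_gt0 fP; rewrite /unif_prob.
set A := [set x in Omega | `[< P x >]]%SET.
have sub : f @: (Omega :\: A) \subset A.
  apply/fintype.subsetP => y /imsetP[x]; rewrite !inE => /andP[+ xO] ->.
  by rewrite xO /= => /asboolPn /(fP x xO)[-> /asboolP].
have := subset_leq_card sub; rewrite card_imset // => le_A.
have AO : (#|A| + #|Omega :\: A| = #|Omega|)%N.
  rewrite -(cardsID A Omega); congr (_ + _)%N; apply: eq_card => x; rewrite !inE.
  by case: (x \in Omega).
rewrite ler_pdivlMr ?ltr0n // mulrAC ler_pdivrMr // mul1r -natrM ler_nat.
by rewrite -AO muln2 -addnn leq_add2l.
Qed.

Lemma compl_class (V : finType) (C : {set sgraph V}) :
  C \in unlabelled_graphs V -> (@compl V @: C)%SET \in unlabelled_graphs V.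
Proof.
move=> /imsetP[G _ ->]; apply/imsetP; exists (compl G) => //.
apply/finset.setP => H; rewrite !inE /= -{1}(complK H) (mem_imset _ _ (can_inj (@complK V))) !inE.
by apply/idP/idP => /compl_iso; rewrite ?complK.
Qed.

Lemma unlabelled_graphs_iso (V : finType) (C : {set sgraph V}) G H :
  C \in unlabelled_graphs V -> G \in C -> H \in C -> sgraph_iso H G.
Proof.
move=> /imsetP[K _ ->]; rewrite !inE /= => KG KH.
have [_ eqv] := sgraph_iso_equiv K H G; rewrite -(eqv KH) //.
Qed.

Unset Implicit Arguments.

Theorem corollary2p2 (R : realType) (n k : nat) (hk : (2 * n + 9 <= k)%N) :
  (1 / 2 <= unif_prob [set: sgraph 'I_k]%SET (fun G => ~ n_apex R n G)) /\
  (1 / 2 <= unif_prob (unlabelled_graphs 'I_k)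
              (fun C => forall G, G \in C -> ~ n_apex R n G)).
Proof.
have V_ge : (2 * n + 9 <= #|{: 'I_k}|)%N by rewrite card_ord.
have compl_inj := can_inj (@complK 'I_k).
split.
  apply: (unif_prob_half compl_inj).
    by rewrite cardsT card_sgraph expn_gt0.
  by move=> G _ /contrapT /(not_apex_compl V_ge).
apply: (unif_prob_half (imset_inj compl_inj)).
  have G0 : sgraph 'I_k := SGraph (finset.sub0set _).
  by apply/card_gt0P; eexists; apply: (imset_f _ (finset.in_setT G0)).
move=> C hC /existsNP[G /not_implyP[GC /contrapT apexG]]; split; first exact: compl_class.
move=> _ /imsetP[H HC ->]; apply: (not_apex_compl V_ge).
by apply: n_apex_iso apexG; exact: (unlabelled_graphs_iso hC).
Qed.
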